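(* Let $\Lambda$ be an artin algebra which is neither Nakayama, nor right $2$-Nakayama, nor right $3$-Nakayama. Then $\Lambda$ is right $4$-Nakayama if and only if every indecomposable right $\Lambda$-module of length greater than $5$ is uniserial and every indecomposable right $\Lambda$-module of length $5$ is local.
   Context: An artin algebra is an algebra $\Lambda$ over a commutative artinian ring $R$ that is finitely generated as an $R$-module. All modules are finitely generated right $\Lambda$-modules. $\mathrm{rad}(M)$ denotes the radical of $M$, and $\mathrm{rad}^0(M)=M$, $\mathrm{rad}^{i+1}(M)=\mathrm{rad}(\mathrm{rad}^i(M))$. A module is local if it has a unique maximal submodule. A module is uniserial (also called $1$-factor serial) if it has a unique composition series. For an integer $n>1$, a non-uniserial module $M$ of length $l\geq n$ is called $n$-factor serial if $M/\mathrm{rad}^{l-n}(M)$ is uniserial and $M/\mathrm{rad}^{l-n+1}(M)$ is not uniserial. $\Lambda$ is called right $n$-Nakayama if every indecomposable right $\Lambda$-module is $i$-factor serial for some $1\leq i\leq n$ and there exists at least one indecomposable $n$-factor serial right $\Lambda$-module. $\Lambda$ is called Nakayama if all indecomposable projective right $\Lambda$-modules and all indecomposable projective left $\Lambda$-modules are uniserial. *)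

(* Defs.v *)
From HB Require Import structures.
From mathcomp Require Import all_boot all_algebra.
From mathcomp Require Import boolp.

Set Implicit Arguments.
Unset Strict Implicit.
Unset Printing Implicit Defensive.

Import GRing.Theory.

Local Open Scope ring_scope.
Local Open Scope quotient_scope.

(* Left A-modules are [lmodType A]; right A-modules are [lmodType A^c], modules
   over the converse ring.  Submodules of M are the terms of the MathComp type
   [submodClosed M]: bundled boolean predicates, which classically are arbitrary
   submodules. *)

Section Submodules.
Variables (A : pzRingType) (M : lmodType A).
Implicit Types N K L : submodClosed M.

Lemma submod_ext N K : N =i K -> N = K.
Proof.
case: N K => [n [[an] [sn]]] [k [[ak] [sk]]] eqnk.
have enk : n = k by apply/funext => x; exact: eqnk.
case: _ / enk ak sk {eqnk} => ak sk.
by rewrite (Prop_irrelevance an ak) (Prop_irrelevance sn sk).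
Qed.

Definition zero_pred : {pred M} := pred1 0.

Fact zero_pred_closed : submod_closed zero_pred.
Proof.
split=> [|a u v]; rewrite !inE ?eqxx // => /eqP-> /eqP->.
by rewrite scaler0 addr0.
Qed.

HB.instance Definition _ := GRing.isSubmodClosed.Build A M zero_pred
  zero_pred_closed.

Definition full_pred : {pred M} := predT.

Fact full_pred_closed : submod_closed full_pred.
Proof. by []. Qed.

HB.instance Definition _ := GRing.isSubmodClosed.Build A M full_pred
  full_pred_closed.

Definition zero_submod : submodClosed M := zero_pred.
Definition full_submod : submodClosed M := full_pred.

Definition maximal_submod N K : Prop :=
  [/\ {subset K <= N}, K <> N &
      forall L, {subset K <= L} -> {subset L <= N} -> L = K \/ L = N].

(* The radical of the submodule N regarded as a module in its own right: the
   submodules of the module N are the submodules of M contained in N.  If N has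
   no maximal submodule then rad N = N. *)
Definition rad_pred N : {pred M} :=
  [pred x | (x \in N) &&
            `[< forall K, maximal_submod N K -> x \in K >]].

Fact rad_pred_closed N : submod_closed (rad_pred N).
Proof.
have rN := submodClosedP N; split=> [|a u v].
  rewrite inE (rN.1); apply/asboolP => K _.
  exact: (submodClosedP K).1.
rewrite !inE => /andP[Nu /asboolP ru] /andP[Nv /asboolP rv].
apply/andP; split; first exact: rN.2.
apply/asboolP => K mK; apply: (submodClosedP K).2; [exact: ru|exact: rv].
Qed.

HB.instance Definition _ N := GRing.isSubmodClosed.Build A M (rad_pred N)
  (rad_pred_closed N).

Definition rad N : submodClosed M := rad_pred N.

Definition rad_iter (i : nat) : submodClosed M := iter i rad full_submod.

(* [:: M_1; ..; M_l] is a composition series if 0 = M_0 < M_1 < .. < M_l = M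
   with each M_i maximal in M_(i+1); the initial 0 is left out, so that the
   length of the series is the size of the sequence. *)
Definition composition_series (s : seq (submodClosed M)) : Prop :=
  path (fun K N => `[< maximal_submod N K >]) zero_submod s
  /\ last zero_submod s = full_submod.

Definition has_length (l : nat) : Prop :=
  exists s, composition_series s /\ size s = l.

Definition uniserial : Prop := exists! s, composition_series s.

Definition local : Prop := exists! K, maximal_submod full_submod K.

Definition finitely_generated : Prop :=
  exists (n : nat) (g : 'I_n -> M),
    forall x, exists a : 'I_n -> A, x = \sum_(i < n) a i *: g i.

(* M <> 0 and M is not the internal direct sum of two nonzero submodules. *)
Definition indecomposable : Prop :=
  full_submod <> zero_submod /\
  forall N K,
    (forall x, x \in N -> x \in K -> x = 0) ->
    (forall x, exists u v, [/\ u \in N, v \in K & x = u + v]) ->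
    N = zero_submod \/ K = zero_submod.

Definition projective : Prop :=
  forall (U V : lmodType A) (p : {linear U -> V}) (f : {linear M -> V}),
    (forall v, exists u, p u = v) ->
    exists h : {linear M -> U}, forall x, p (h x) = f x.

End Submodules.

Arguments has_length {A} M l.
Arguments uniserial {A} M.
Arguments local {A} M.
Arguments finitely_generated {A} M.
Arguments indecomposable {A} M.
Arguments projective {A} M.
Arguments rad_iter {A} M i.
Arguments full_submod {A} M.
Arguments zero_submod {A} M.

(* The quotient module M / N, extending the Z-module quotient of
   [ring_quotient] by the induced scaling. *)
Section QuotientModule.
Variables (A : pzRingType) (M : lmodType A) (N : submodClosed M).

Definition quot_pred : {pred M} := N.

Fact quot_pred_closed : zmod_closed quot_pred.
Proof. exact: (GRing.submod_closedB (submodClosedP N)). Qed.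

HB.instance Definition _ := GRing.isZmodClosed.Build M quot_pred
  quot_pred_closed.

Definition quotmod : Type := Quotient.quot quot_pred.

HB.instance Definition _ := GRing.Zmodule.on quotmod.
HB.instance Definition _ : EqQuotient M (Quotient.equiv quot_pred) quotmod :=
  EqQuotient.on quotmod.

Definition quot_scale (a : A) (q : quotmod) : quotmod :=
  \pi_quotmod (a *: repr q).

Lemma eq_piP (x y : M) : reflect (\pi_quotmod x = \pi_quotmod y) (x - y \in N).
Proof. by rewrite (Quotient.idealrBE quot_pred x y); apply: eqP. Qed.

Lemma pi_scale (a : A) (x : M) :
  quot_scale a (\pi_quotmod x) = \pi_quotmod (a *: x).
Proof.
apply/eq_piP; rewrite -scalerBr; apply: rpredZ.
by apply/eq_piP; rewrite reprK.
Qed.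

Lemma pi_add (x y : M) :
  \pi_quotmod (x + y) = (\pi_quotmod x : quotmod) + \pi_quotmod y.
Proof. exact: (Quotient.pi_add quot_pred x y). Qed.

Fact quot_scalerA a b q : quot_scale a (quot_scale b q) = quot_scale (a * b) q.
Proof. by rewrite -[q]reprK (pi_scale b) !pi_scale scalerA. Qed.

Fact quot_scale1r : left_id 1 quot_scale.
Proof. by move=> q; rewrite -[q]reprK pi_scale scale1r. Qed.

Fact quot_scalerDr : right_distributive quot_scale +%R.
Proof.
move=> a p q; rewrite -[p]reprK -[q]reprK.
by rewrite -pi_add !pi_scale scalerDr pi_add.
Qed.

Fact quot_scalerDl q : {morph quot_scale^~ q : a b / a + b}.
Proof. by move=> a b; rewrite -[q]reprK !pi_scale scalerDl pi_add. Qed.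

HB.instance Definition _ := GRing.Zmodule_isLmodule.Build A quotmod
  quot_scalerA quot_scale1r quot_scalerDr quot_scalerDl.

End QuotientModule.

Section FactorSerial.
Variables (A : pzRingType) (M : lmodType A).

(* There is no 0-factor serial module. *)
Definition factor_serial (n : nat) : Prop :=
  match n with
  | 0 => False
  | 1 => uniserial M
  | _ => ~ uniserial M /\
         exists l, [/\ has_length M l, (n <= l)%N,
                       uniserial (quotmod (rad_iter M (l - n))) &
                       ~ uniserial (quotmod (rad_iter M (l - n + 1)))]
  end.

End FactorSerial.

Arguments factor_serial {A} M n.

Definition artinian (R : comPzRingType) : Prop :=
  forall I : nat -> submodClosed R^o,
    (forall n, {subset I n.+1 <= I n}) ->
    exists n, forall m, (n <= m)%N -> I m = I n.

Definition artin_algebra (R : comPzRingType) (Lambda : algType R) : Prop :=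
  artinian R /\ finitely_generated Lambda.

Definition right_nakayama (n : nat) (A : pzRingType) : Prop :=
  (forall M : lmodType A^c, finitely_generated M -> indecomposable M ->
     exists i, (1 <= i <= n)%N /\ factor_serial M i)
  /\ exists M : lmodType A^c,
       [/\ finitely_generated M, indecomposable M & factor_serial M n].

Definition nakayama (A : pzRingType) : Prop :=
  (forall P : lmodType A^c,
     finitely_generated P -> indecomposable P -> projective P -> uniserial P)
  /\ (forall P : lmodType A,
     finitely_generated P -> indecomposable P -> projective P -> uniserial P).

(* Main.v *)
(* If M is indecomposable, not uniserial and n-factor serial of length l, put
   k = l - n: then M / rad^k M is uniserial and rad^k M has two distinct maximal
   submodules K1 and K2.  When k > 1 (forced by n <= 4 < 6 <= l), the fibre product of
   the uniserial modules M / K2 and M / K1 over M / rad^(k-1) M has length k + 3 >= 5,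
   is not local, and is indecomposable; being i-factor serial with i <= 4 it would
   have to be local.
   Conversely the length conditions bound n by 4, so if 4 is not attained all
   indecomposable right modules are uniserial, and it remains to see that
   indecomposable projective left modules are uniserial.  For idempotents e, f, g
   from a decomposition of 1 and a in f A e, b in g A e, the right module
   (f A + g A) / (a, b) A is a sum of uniserial modules, which forces a in A b or
   b in A a; hence each A e, and each of its submodules, is uniserial. *)

From HB Require Import structures.
From mathcomp Require Import all_boot all_algebra.
From mathcomp Require Import boolp classical_sets zify.
Require Import Defs.

Set Implicit Arguments.
Unset Strict Implicit.
Unset Printing Implicit Defensive.

Import GRing.Theory.
Local Open Scope ring_scope.

(** * Lattice of submodules and lengths *)

Section SubmoduleLattice.
Variables (A : pzRingType) (M : lmodType A).
Implicit Types N K L H : submodClosed M.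

(** Why the fibre product is indecomposable: its radical is the image of $rad M$, which has a simple
    top because $k > 1$, so it lies in one summand [Y]. The [Y]-component of $(0, v)$ has the same
    annihilator as $(0, v)$ and spans a uniserial module of length 2. A nonzero complement would
    force this module to contain the image of $rad^k M$, which is semisimple of length 2. The
    constants: a non-uniserial module of length [l] has index $l - k$, and locality means $k \ge 1$.
    At length 5 it is thus exactly locality that keeps the index at most 4. The module $(fA +
    gA)/(a,b)A$ is handled as a one-relation presentation. A decomposition allows a change of
    generators adapted to it; this acts on the pair $(a, b)$ by invertible operations, and the local
    corner rings make comparability of [a] and [b] insensitive to them. *)

Fact asbool_submod_closed (P : M -> Prop) (P0 : P 0)
    (PD : forall a u v, P u -> P v -> P (a *: u + v)) :
  submod_closed [pred x : M | `[< P x >]].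
Proof. by split=> [|a u v]; rewrite !inE //; apply: PD. Qed.

Definition mksub P P0 PD : submodClosed M :=
  HB.pack_for (submodClosed M) ([pred x | `[< P x >]] : {pred M})
    (GRing.isSubmodClosed.Build A M _ (@asbool_submod_closed P P0 PD)).

Lemma mksubP P P0 PD x : reflect (P x) (x \in @mksub P P0 PD).
Proof. exact: (asboolP (P x)). Qed.

Lemma submN N x : x \in N -> - x \in N.
Proof. by move=> Nx; rewrite -scaleN1r; apply: rpredZ. Qed.

Lemma submB N x y : x \in N -> y \in N -> x - y \in N.
Proof. by move=> Nx Ny; apply: rpredD => //; apply: submN. Qed.

Lemma sub_anti N K : {subset N <= K} -> {subset K <= N} -> N = K.
Proof. by move=> NK KN; apply: submod_ext => x; apply/idP/idP; auto. Qed.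

Lemma sub0 N : {subset zero_submod M <= N}.
Proof. by move=> x /eqP ->; apply: rpred0. Qed.

Lemma subT N : {subset N <= full_submod M}. Proof. by []. Qed.

Lemma notsub N K : ~ {subset N <= K} -> exists2 x, x \in N & x \notin K.
Proof.
move=> nNK; apply: contrapT => nex; apply: nNK => x Nx; apply: contrapT => nK.
by apply: nex; exists x => //; apply/negP.
Qed.

Definition meetS N K : submodClosed M.
Proof.
apply: (@mksub (fun x => x \in N /\ x \in K)) => [|a u v [? ?] [? ?]].
  by split; apply: rpred0.
by split; apply: rpredD => //; apply: rpredZ.
Defined.

Lemma meetSP N K x : reflect (x \in N /\ x \in K) (x \in meetS N K).
Proof. exact: mksubP. Qed.

Definition addS N K : submodClosed M.
Proof.
apply: (@mksub (fun x => exists2 u, u \in N & x - u \in K)) => [|a x y].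
  by exists 0; rewrite ?subr0; apply: rpred0.
move=> [u Nu Ku] [v Nv Kv]; exists (a *: u + v).
  by apply: rpredD => //; apply: rpredZ.
rewrite opprD addrACA -scalerBr.
by apply: rpredD => //; apply: rpredZ.
Defined.

Lemma addSP N K x : reflect (exists2 u, u \in N & x - u \in K) (x \in addS N K).
Proof. exact: mksubP. Qed.

Lemma addSl N K : {subset N <= addS N K}.
Proof. by move=> x Nx; apply/addSP; exists x => //; rewrite subrr rpred0. Qed.

Lemma addSr N K : {subset K <= addS N K}.
Proof. by move=> x Kx; apply/addSP; exists 0; rewrite ?subr0 ?rpred0. Qed.

Lemma addS_lub N K L :
  {subset N <= L} -> {subset K <= L} -> {subset addS N K <= L}.
Proof.
move=> NL KL x /addSP[u Nu Kxu].
by rewrite -(subrK u x) addrC; apply: rpredD; [apply: NL|apply: KL].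
Qed.

Lemma meetSl N K : {subset meetS N K <= N}.
Proof. by move=> x /meetSP[]. Qed.

Lemma meetSr N K : {subset meetS N K <= K}.
Proof. by move=> x /meetSP[]. Qed.

Definition cyclicS (x : M) : submodClosed M.
Proof.
apply: (@mksub (fun y => exists a, y = a *: x)) => [|a _ _ [b ->] [c ->]].
  by exists 0; rewrite scale0r.
by exists (a * b + c); rewrite scalerDl scalerA.
Defined.

Lemma cyclicSP x y : reflect (exists a, y = a *: x) (y \in cyclicS x).
Proof. exact: mksubP. Qed.

Lemma cyclicS_id x : x \in cyclicS x.
Proof. by apply/cyclicSP; exists 1; rewrite scale1r. Qed.

Lemma cyclicS_sub x N : x \in N -> {subset cyclicS x <= N}.
Proof. by move=> Nx _ /cyclicSP[a ->]; apply: rpredZ. Qed.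

Definition covers K N := maximal_submod N K.

Lemma covers_sub K N : covers K N -> {subset K <= N}. Proof. by case. Qed.

Lemma coversE K N x : covers K N -> x \in N -> x \notin K ->
  {subset N <= addS K (cyclicS x)}.
Proof.
move=> [KN _ maxK] Nx nKx.
case: (maxK (addS K (cyclicS x))) => [||e|<- //].
- exact: addSl.
- by apply: addS_lub => //; apply: cyclicS_sub.
- by case/negP: nKx; rewrite -e; apply: addSr; apply: cyclicS_id.
Qed.

(* Diamond isomorphism: [meetS K L, L] is mapped onto [K, addS K L]. *)
Lemma covers_add K L : covers (meetS K L) L -> covers K (addS K L).
Proof.
move=> [_ KL_L maxK]; split; first exact: addSl.
  move=> e; apply: KL_L; apply: sub_anti; first exact: meetSr.
  by move=> x Lx; apply/meetSP; split=> //; rewrite e; apply: addSr.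
move=> H KH HKL; case: (maxK (meetS H L)).
- by move=> x /meetSP[Kx Lx]; apply/meetSP; split=> //; apply: KH.
- exact: meetSr.
- move=> e; left; apply: sub_anti => // x Hx.
  have /addSP[u Ku Lxu] := HKL _ Hx.
  rewrite -(subrK u x); apply: rpredD => //.
  apply: (@meetSl K L); rewrite -e; apply/meetSP; split=> //.
  by apply: submB => //; apply: KH.
- move=> e; right; apply: sub_anti => //; apply: addS_lub => // x.
  by rewrite -e => /meetSP[].
Qed.

Lemma covers_meet K L : covers K (addS K L) -> covers (meetS K L) L.
Proof.
move=> [_ KL_L maxK]; split; first exact: meetSr.
  move=> e; apply: KL_L; apply: sub_anti; first exact: addSl.
  by apply: addS_lub => // x; rewrite -e => /meetSP[].
move=> H KH HKL; case: (maxK (addS K H)).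
- exact: addSl.
- by apply: addS_lub; [apply: addSl|move=> x /HKL; apply: addSr].
- move=> e; left; apply: sub_anti => // x Hx.
  apply/meetSP; split; last exact: HKL.
  by rewrite -e; apply: addSr.
- move=> e; right; apply: sub_anti => // x Lx.
  have : x \in addS K H by rewrite e; apply: addSr.
  case/addSP=> u Ku Hxu; rewrite -(subrK u x); apply: rpredD => //.
  apply: KH; apply/meetSP; split=> //.
  rewrite -(subKr x u); apply: submB => //; exact: HKL.
Qed.

(** Length of the subquotient $N/K$, read off a maximal chain between [K] and [N], so that
    subquotients need not be formed as modules. *)
Inductive clen : submodClosed M -> submodClosed M -> nat -> Prop :=
| clen0 K : clen K K 0
| clenS K L N l : covers K L -> clen L N l -> clen K N l.+1.

Lemma clen_sub K N l : clen K N l -> {subset K <= N}.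
Proof.
by elim=> [K0|K0 L N0 m KL _ LN x Kx] //; apply/LN/(covers_sub KL).
Qed.

Lemma clen_trans K L N l m : clen K L l -> clen L N m -> clen K N (l + m).
Proof.
by elim=> [//|K0 L0 N0 k KL _ LN /LN]; rewrite addSn; apply: clenS.
Qed.

Lemma clen1 K N : covers K N -> clen K N 1.
Proof. by move/clenS; apply; apply: clen0. Qed.

Lemma clen_eq K l : clen K K l -> l = 0.
Proof.
move e : {2}K => N c; case: c e => // K' L N' m KL /clen_sub LN e.
case: KL => KL nKL _; case: nKL; apply: sub_anti => // x /LN; by rewrite -e.
Qed.

Lemma clen_zero K N : clen K N 0 -> K = N.
Proof. by move=> c; inversion c. Qed.

Lemma has_lengthP l : has_length M l <-> clen (zero_submod M) (full_submod M) l.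
Proof.
rewrite /has_length /composition_series; split.
  case=> s [[+ +] +]; elim: s (zero_submod M) l => [|N s IHs] K l /=.
    by move=> _ -> <-; apply: clen0.
  move=> /andP[/asboolP KN p] e; case: l => // l [] e'.
  exact: clenS KN (IHs _ _ p e e').
elim=> [K|K L N m KL _ [s [[p e] e']]]; first by exists [::].
exists (L :: s); split=> /=; last by rewrite e'.
by rewrite p andbT; split=> //; apply/asboolP.
Qed.

Lemma meet_eql K L : {subset K <= L} -> meetS K L = K.
Proof.
move=> KL; apply: sub_anti => [|x Kx]; first exact: meetSl.
by apply/meetSP; split=> //; apply: KL.
Qed.

Lemma add_eql K L : {subset L <= K} -> addS K L = K.
Proof. by move=> LK; apply: sub_anti; [apply: addS_lub|apply: addSl]. Qed.

Lemma meetSC K L : meetS K L = meetS L K.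
Proof. by apply: submod_ext => x; apply/meetSP/meetSP; case. Qed.

Lemma addSC K L : addS K L = addS L K.
Proof.
by apply: sub_anti; apply: addS_lub => x; by [apply: addSr|apply: addSl].
Qed.

Lemma modS K L N : {subset K <= N} ->
  meetS (addS K L) N = addS K (meetS L N).
Proof.
move=> KN; apply: sub_anti => x.
  case/meetSP => /addSP[u Ku Lu] Nx; apply/addSP; exists u => //.
  by apply/meetSP; split=> //; apply: submB => //; apply: KN.
case/addSP=> u Ku /meetSP[Lu Nu]; apply/meetSP; split.
  by apply/addSP; exists u.
by rewrite -(subrK u x); apply: rpredD => //; apply: KN.
Qed.

(** Intersecting the chain from [K] to $K + L$ with [L] keeps every step a cover, by the modular law
    and the diamond. *)
Lemma clen_meet K L l : clen K (addS K L) l -> clen (meetS K L) L l.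
Proof.
move e : (addS K L) => N c; elim: c L e => {K N l}[K|K H N l KH HN IH] L e.
  rewrite meetSC meet_eql; first exact: clen0.
  by move=> x Lx; rewrite -e; apply: addSr.
have KHs := covers_sub KH; have HNs := clen_sub HN.
have eH : addS H L = N.
  apply: sub_anti; first by apply: addS_lub => // x Lx; rewrite -e; apply: addSr.
  rewrite -e; apply: addS_lub => x ?; first exact/addSl/KHs.
  exact: addSr.
apply: clenS (IH _ eH).
have eK : addS K (meetS H L) = H.
  by rewrite [meetS H L]meetSC -modS // e meetSC meet_eql.
have := @covers_meet K (meetS H L); rewrite eK => /(_ KH).
suff -> : meetS K (meetS H L) = meetS K L by [].
apply: submod_ext => x; apply/meetSP/meetSP => [[Kx /meetSP[]]//|[Kx Lx]].
by split=> //; apply/meetSP; split=> //; apply: KHs.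
Qed.

(** The refinement behind Jordan-Hölder. If the first step [H] lies in [L], recurse; otherwise $L
    \cap H = K$, and the diamond trades the step $K < H$ for $L < L + H$. *)
Lemma clen_split K L N l : clen K N l -> {subset K <= L} -> {subset L <= N} ->
  exists l1 l2, [/\ clen K L l1, clen L N l2 & l = (l1 + l2)%N].
Proof.
move=> c; elim: c L => {K N l}[K|K H N l KH HN IH] L KL LN.
  have -> : L = K by apply: sub_anti.
  by exists 0, 0; split=> //; apply: clen0.
have [HL|nHL] := pselect {subset H <= L}.
  have [l1 [l2 [c1 c2 ->]]] := IH _ HL LN.
  by exists l1.+1, l2; split=> //; apply: clenS c1.
have HNs := clen_sub HN; have KHs := covers_sub KH.
have eK : meetS L H = K.
  have [KHs' _ maxK] := KH; case: (maxK (meetS L H)) => // [x Kx||e].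
  - by apply/meetSP; split; [apply: KL|apply: KHs].
  - exact: meetSr.
  - by case: nHL => x; rewrite -e => /meetSP[].
have [||l1 [l2 [c1 c2 ->]]] := IH (addS H L).
- exact: addSl.
- exact: addS_lub.
have c3 := clen_meet c1; rewrite meetSC eK in c3.
exists l1, l2.+1; split=> //; last by rewrite addnS.
by apply: clenS c2; rewrite addSC; apply: covers_add; rewrite eK.
Qed.

Lemma covers_clen K N l : covers K N -> clen K N l -> l = 1.
Proof.
move=> KN c; case: c KN => [K' [_ []]//|K' L N' m KL LN [_ _ maxK]].
have Ls := clen_sub LN; have KLs := covers_sub KL.
case: (maxK L) => // [e|e]; first by case: KL => _ []; rewrite e.
by rewrite e in LN; rewrite (clen_eq LN).
Qed.

Lemma clen_uniq K N l m : clen K N l -> clen K N m -> l = m.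
Proof.
move=> + c; elim: c l => {K N m}[K l /clen_eq//|K L N m KL LN IH l c].
have [l1 [l2 [c1 c2 ->]]] := clen_split c (covers_sub KL) (clen_sub LN).
by rewrite (covers_clen KL c1) (IH _ c2).
Qed.

Lemma clen_lt K L N l : clen K N l -> {subset K <= L} -> {subset L <= N} ->
  exists2 m, clen K L m & (m <= l)%N /\ (L <> N -> (m < l)%N).
Proof.
move=> c KL LN; have [l1 [l2 [c1 c2 ->]]] := clen_split c KL LN.
exists l1 => //; split; first exact: leq_addr.
move=> nLN; rewrite -[X in (X < _)%N]addn0 ltn_add2l.
by case: l2 c2 => // c2; case: nLN; inversion c2.
Qed.

Definition strict_mono_on K N (mu : submodClosed M -> nat) :=
  forall L H, {subset K <= L} -> {subset L <= H} -> {subset H <= N} ->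
    L <> H -> (mu L < mu H)%N.

(** Among the submodules strictly above [K], one of least rank covers [K]. Since ranks can be pulled
    back along maps, this transfers finite length without exact sequences. *)
Lemma rank_clen mu K N : strict_mono_on K N mu -> {subset K <= N} ->
  exists l, clen K N l.
Proof.
have [n] := ubnP (mu N - mu K)%N; elim: n K => // n IHn K lt_n smu KN.
have [->|nKN] := pselect (K = N); first by exists 0; apply: clen0.
pose P m := `[< exists L, [/\ {subset K <= L}, {subset L <= N}, L <> K & mu L = m] >].
have exP : exists m, P m.
  by exists (mu N); apply/asboolP; exists N; split=> //; apply/nesym.
case: (ex_minnP exP) => m /asboolP[L [KL LN nLK eLm] minL].
have ltKL : (mu K < mu L)%N by apply: smu => //; apply/nesym.
have ltKN : (mu K < mu N)%N by apply: smu.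
have [|H H' LH|l c] := IHn L _ _ LN.
- rewrite ltnS in lt_n; apply: leq_trans lt_n.
  by apply: ltn_sub2l.
- by apply: smu => x /KL /LH.
exists l.+1; apply: clenS c; split=> //; first exact/nesym.
move=> H KH HL; apply: contrapT => /not_orP[nHK nHL].
have HN : {subset H <= N} by move=> x /HL /LN.
have : (mu H < mu L)%N by apply: smu.
by rewrite ltnNge eLm minL //; apply/asboolP; exists H.
Qed.

Lemma clen_rank l : clen (zero_submod M) (full_submod M) l ->
  exists mu, forall N, clen (zero_submod M) N (mu N).
Proof.
move=> c; suff /boolp.choice[mu cmu] N : exists m, clen (zero_submod M) N m.
  by exists mu.
by have [m cm _] := clen_lt c (@sub0 N) (@subT N); exists m.
Qed.

Lemma clen_strict mu : (forall N, clen (zero_submod M) N (mu N)) ->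
  forall N K, {subset K <= N} -> K <> N -> (mu K < mu N)%N.
Proof.
move=> cmu N K KN nKN; have [m cm [_ /(_ nKN)]] := clen_lt (cmu N) (@sub0 K) KN.
by rewrite (clen_uniq cm (cmu K)).
Qed.

End SubmoduleLattice.

(** * Linear maps, quotients and uniserial modules *)

Section LinearMaps.
Variables (A : pzRingType) (M Q : lmodType A) (f : {linear M -> Q}).

Definition preimS (K : submodClosed Q) : submodClosed M.
Proof.
apply: (@mksub _ M (fun x => f x \in K)) => [|a u v fu fv].
  by rewrite linear0 rpred0.
by rewrite linearP rpredD // rpredZ.
Defined.

Lemma preimSP K x : (x \in preimS K) = (f x \in K).
Proof. exact/mksubP/idP. Qed.

Definition imS (N : submodClosed M) : submodClosed Q.
Proof.
apply: (@mksub _ Q (fun y => exists2 x, x \in N & y = f x)).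
  by exists 0; rewrite ?linear0 ?rpred0.
move=> a _ _ [u Nu ->] [v Nv ->]; exists (a *: u + v).
  by rewrite rpredD // rpredZ.
by rewrite linearP.
Defined.

Lemma imSP (N : submodClosed M) y : reflect (exists2 x, x \in N & y = f x) (y \in imS N).
Proof. exact: mksubP. Qed.

Lemma imS_mem (N : submodClosed M) x : x \in N -> f x \in imS N.
Proof. by move=> Nx; apply/imSP; exists x. Qed.

Lemma imS_mono (N N' : submodClosed M) : {subset N <= N'} -> {subset imS N <= imS N'}.
Proof. by move=> NN y /imSP[x /NN Nx ->]; apply: imS_mem. Qed.

Lemma rad_im (N : submodClosed M) : {subset imS (rad N) <= rad (imS N)}.
Proof.
move=> _ /imSP[x + ->]; rewrite inE => /andP[Nx /asboolP maxx].
rewrite inE imS_mem //=; apply/asboolP => K [KN nKN maxK].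
suff /maxx/meetSP[_] : maximal_submod N (meetS N (preimS K)) by rewrite preimSP.
split=> [||L NKL LN]; first exact: meetSl.
  move=> e; apply: nKN; apply: sub_anti => // _ /imSP[y Ny ->].
  by move: Ny; rewrite -e => /meetSP[_]; rewrite preimSP.
have [||e|e] := maxK (addS K (imS L)); first exact: addSl.
- by apply: addS_lub => //; apply: imS_mono.
- left; apply: sub_anti => // y Ly; apply/meetSP; split; first exact: LN.
  by rewrite preimSP -e; apply: addSr; apply: imS_mem.
- right; apply: sub_anti => // y Ny.
  have : f y \in addS K (imS L) by rewrite e imS_mem.
  case/addSP=> u Ku /imSP[z Lz fyu]; rewrite -(subrK z y).
  apply: rpredD => //; apply: NKL; apply/meetSP; split.
    by apply: submB => //; apply: LN.
  by rewrite preimSP linearB -fyu opprB addrC subrK.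
Qed.

End LinearMaps.

Section FiniteLength.
Variables (A : pzRingType) (M : lmodType A).
Implicit Types N K L H : submodClosed M.

Definition finlen := exists l, has_length M l.

Lemma finlen_clen K N : finlen -> {subset K <= N} -> exists l, clen K N l.
Proof.
move=> [l /has_lengthP c] KN.
have [l1 [l2 [_ c' _]]] := clen_split c (@sub0 _ _ K) (@subT _ _ K).
by have [l3 [l4 [c3 _ _]]] := clen_split c' KN (@subT _ _ N); exists l3.
Qed.

Lemma finlen_rank : finlen ->
  exists mu, strict_mono_on (zero_submod M) (full_submod M) mu.
Proof.
move=> [l /has_lengthP c]; have [mu cmu] := clen_rank c; exists mu.
by move=> L H _ LH _ nLH; apply: (clen_strict cmu).
Qed.

Lemma rank_finlen mu : strict_mono_on (zero_submod M) (full_submod M) mu -> finlen.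
Proof.
move=> smu; have [//|l c] := rank_clen smu.

by exists l; apply/has_lengthP.
Qed.

Lemma clen_maximal K N l : clen K N l -> K <> N ->
  exists2 H, covers H N & {subset K <= H}.
Proof.
elim=> {K N l}[//|K L N l KL LN IH] nKN.
have [e|/IH[H HN LH]] := pselect (L = N); first by exists K; rewrite -?e.
by exists H => // x Kx; apply: LH; apply: covers_sub Kx.
Qed.

Lemma finlen_maximal K N : finlen -> {subset K <= N} -> K <> N ->
  exists2 H, covers H N & {subset K <= H}.
Proof. by move=> fM KN; have [l] := finlen_clen fM KN; apply: clen_maximal. Qed.

Lemma radP N x :
  reflect (x \in N /\ forall K, covers K N -> x \in K) (x \in rad N).
Proof.
rewrite inE; apply: (iffP andP) => -[Nx].
  by move/asboolP.
by move=> ?; split=> //; apply/asboolP.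
Qed.

Lemma rad_sub N : {subset rad N <= N}.
Proof. by move=> x /radP[]. Qed.

Lemma rad_covers K N : covers K N -> {subset rad N <= K}.
Proof. by move=> KN x /radP[_]; apply. Qed.

(** Nakayama's lemma: a proper [L] lies in a maximal submodule of [N], which contains the radical as
    well. *)
Lemma rad_superfluous N L : finlen -> {subset L <= N} ->
  {subset N <= addS (rad N) L} -> L = N.
Proof.
move=> fM LN sN; apply: contrapT => /(finlen_maximal fM LN)[H HN LH].
case: (HN) => HN' []; apply: sub_anti => // x /sN.
by apply: addS_lub => //; apply: rad_covers.
Qed.

Lemma rad_neq N : finlen -> N <> zero_submod M -> rad N <> N.
Proof.
move=> fM nN0 e; apply: nN0; apply/esym/rad_superfluous => //; first exact: sub0.
by rewrite e; apply: addSl.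
Qed.

(** A maximal submodule of [N'] either contains [N] or cuts it in a maximal submodule. *)
Lemma rad_mono N N' : {subset N <= N'} -> {subset rad N <= rad N'}.
Proof.
move=> NN' x /radP[Nx maxx]; apply/radP; split=> [|K KN']; first exact: NN'.
have [NK|/notsub[y Ny nKy]] := pselect {subset N <= K}; first exact: NK.
have eN : addS K N = N'.
  apply: sub_anti; first by apply: addS_lub => //; apply: covers_sub.
  move=> z Nz; have := coversE KN' (NN' _ Ny) nKy Nz.
  apply: addS_lub; first exact: addSl.
  by apply: cyclicS_sub; apply: addSr.
by have /meetSP[] := maxx (meetS K N) (covers_meet (eq_ind_r (covers K) KN' eN)).
Qed.

Lemma rad_iter_sub j k : (j <= k)%N -> {subset rad_iter M k <= rad_iter M j}.
Proof.
move/subnK <-; elim: (k - j)%N => // n IHn x; rewrite addSn => /rad_sub; exact: IHn.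
Qed.

(** For [M] of finite length this is uniseriality of $M/H$, expressed in the lattice of [M]. *)
Definition chain_above H := forall N K, {subset H <= N} -> {subset H <= K} ->
  {subset N <= K} \/ {subset K <= N}.

Definition total_submod := chain_above (zero_submod M).

Let covb := fun K N : submodClosed M => `[< maximal_submod N K >].

Lemma clen_path K N l : clen K N l <->
  exists s, [/\ path covb K s, last K s = N & size s = l].
Proof.
split.
  elim=> [K0|K0 L N0 m KL _ [s [p e e']]]; first by exists [::].
  exists (L :: s); split=> //=; last by rewrite e'.
  by rewrite p andbT; apply/asboolP.
case=> s [+ + <-]; elim: s K => [|L s IHs] K /=; first by move=> _ ->; apply: clen0.
by move=> /andP[/asboolP KL p] /(IHs _ p); apply: clenS.
Qed.

Lemma cat_prefix (T : Type) (s1 s2 t1 t2 : seq T) : (size s1 <= size t1)%N ->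
  s1 ++ s2 = t1 ++ t2 -> exists r, t1 = s1 ++ r.
Proof.
elim: s1 t1 => [|x s1 IHs] [|y t1] //=; [by exists [::]|by eexists|].
by rewrite ltnS => /IHs IH [-> /IH[r ->]]; exists r.
Qed.

(** Series refined through [N] and through [K] are the same list by uniqueness, so the initial
    segment of one is a prefix of that of the other. Conversely, in a chain two covers of the same
    submodule coincide. *)
Lemma uniserialP : uniserial M <-> finlen /\ total_submod.
Proof.
split=> [[s [[ps ls] us]]|[[l [s [cs _]]] tot]].
  have fM : finlen by exists (size s), s.
  split=> // N K _ _.
  have [l1 /clen_path[s1 [p1 e1 _]]] := finlen_clen fM (@sub0 _ _ N).
  have [l2 /clen_path[s2 [p2 e2 _]]] := finlen_clen fM (@subT _ _ N).
  have [l3 /clen_path[t1 [q1 f1 _]]] := finlen_clen fM (@sub0 _ _ K).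
  have [l4 /clen_path[t2 [q2 f2 _]]] := finlen_clen fM (@subT _ _ K).
  have es : s = s1 ++ s2.
    by apply: us; split; rewrite ?cat_path ?last_cat e1 // p2 andbT.
  have et : s = t1 ++ t2.
    by apply: us; split; rewrite ?cat_path ?last_cat f1 // q2 andbT.
  rewrite es in et; have [le|le] := leqP (size s1) (size t1).
    left; have [r er] := cat_prefix le et; apply: (@clen_sub _ _ _ _ (size r)).
    apply/clen_path; exists r; split=> //.
      by move: q1; rewrite er cat_path e1 => /andP[].
    by rewrite -f1 er last_cat e1.
  right; have [r er] := cat_prefix (ltnW le) (esym et).
  apply: (@clen_sub _ _ _ _ (size r)); apply/clen_path; exists r; split=> //.
    by move: p1; rewrite er cat_path f1 => /andP[].
  by rewrite -e1 er last_cat f1.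
exists s; split=> // t ct; case: cs ct => ps ls [pt lt].
have full_top K L : covers K L -> K <> full_submod M.
  by move=> [KL nKL _] e; apply: nKL; apply: sub_anti => // x _; rewrite e.
elim: s t (zero_submod M) ps ls pt lt => [|K s IHs] [|L t] H //=.
- by move=> _ eH /andP[/asboolP/full_top].
- by move=> /andP[/asboolP/full_top + _] _ _ eH.
move=> /andP[/asboolP HK ps] ls /andP[/asboolP HL pt] lt.
suff eKL : K = L by rewrite -eKL in lt pt *; rewrite (IHs t K).
case: (HK) (HL) => [sK nK maxK] [sL nL maxL].
case: (tot K L) => [||KL|LK]; try exact: sub0.
- by case: (maxL K) => // e; case: nK; rewrite e.
- by case: (maxK L) => // e; case: nL; rewrite e.
Qed.

End FiniteLength.

Lemma finlen_surj (A : pzRingType) (M Q : lmodType A) (f : {linear M -> Q}) :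
  (forall y, exists x, f x = y) -> finlen M -> finlen Q.
Proof.
move=> sf /finlen_rank[mu smu]; apply: (@rank_finlen _ _ (mu \o preimS f)).
move=> L H _ LH _ nLH; apply: smu => [||//|e]; first exact: sub0.
  by move=> x; rewrite !preimSP; apply: LH.
apply: nLH; apply: sub_anti => // y; have [x <-] := sf y.
by rewrite -!preimSP e.
Qed.

Section Quotients.
Variables (A : pzRingType) (M : lmodType A) (H : submodClosed M).

Definition piQ (x : M) : quotmod H := (\pi_(quotmod H) x)%qT.

Lemma piQ_linear : linear piQ.
Proof. by move=> a x y; rewrite /piQ pi_add -pi_scale. Qed.

HB.instance Definition _ :=
  GRing.isLinear.Build A M (quotmod H) _ piQ piQ_linear.

Lemma piQ_surj y : exists x, piQ x = y.
Proof. by exists (repr y); rewrite /piQ reprK. Qed.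

Lemma piQ_eq0 x : (piQ x == 0) = (x \in H).
Proof.
rewrite -(linear0 piQ); apply/eqP/idP => [/eq_piP|Hx]; first by rewrite subr0.
by apply/eq_piP; rewrite subr0.
Qed.

Lemma quot_total : total_submod (quotmod H) <-> chain_above H.
Proof.
have ker_pre K : {subset H <= preimS piQ K}.
  by move=> x; rewrite -piQ_eq0 preimSP /= => /eqP ->; apply: rpred0.
split=> tot N K.
  have imK (L : submodClosed M) x : {subset H <= L} -> piQ x \in imS piQ L -> x \in L.
    move=> HL /imSP[y Ly /= e]; rewrite -(subrK y x); apply: rpredD => //.
    by apply: HL; rewrite -piQ_eq0 linearB /= e subrr.
  move=> HN HK; have [||NK|KN] := tot (imS piQ N) (imS piQ K); try exact: sub0.
    by left=> x Nx; apply: imK => //; apply: NK; apply: imS_mem.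
  by right=> x Kx; apply: imK => //; apply: KN; apply: imS_mem.
move=> _ _; have [NK|KN] := tot _ _ (ker_pre N) (ker_pre K); [left|right] => y;
  by have [x <-] := piQ_surj y; rewrite -!preimSP; auto.
Qed.

Lemma quot_uniserial : finlen M -> uniserial (quotmod H) <-> chain_above H.
Proof.
move=> fM; rewrite uniserialP quot_total; split=> [[]//|]; split=> //.
exact: finlen_surj piQ_surj fM.
Qed.

End Quotients.

(** * Radical layers *)

Section RadicalChain.
Variables (A : pzRingType) (M : lmodType A) (fM : finlen M).
Implicit Types N K L H : submodClosed M.

Lemma covers_chain_uniq H N K L : chain_above H -> {subset H <= K} ->
  {subset H <= L} -> covers K N -> covers L N -> K = L.
Proof.
move=> ch HK HL [sK nK maxK] [sL nL maxL].
case: (ch K L HK HL) => [KL|LK].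
- by case: (maxK L) => // e; case: nL.
- by case: (maxL K) => // e; case: nK.
Qed.

Lemma rad_covers_chain k j : chain_above (rad_iter M k) -> (j < k)%N ->
  rad_iter M j <> zero_submod M -> covers (rad_iter M j.+1) (rad_iter M j).
Proof.
move=> ch jk nz.
have [|K cK _] := finlen_maximal fM (@sub0 _ _ (rad_iter M j)).
  exact/nesym.
suff -> : rad_iter M j.+1 = K by [].
have radK L : covers L (rad_iter M j) -> {subset rad_iter M k <= L}.
  move=> cL x xk; apply: (rad_covers cL).
  exact: (@rad_iter_sub _ _ j.+1 k).
apply: sub_anti; first exact: rad_covers.
move=> x Kx; apply/radP; split; first exact: covers_sub Kx.
by move=> L cL; rewrite -(covers_chain_uniq ch (radK _ cK) (radK _ cL) cK cL).
Qed.

(** Descend by layers: an [L] strictly inside $rad^d M$ lies in a maximal submodule of it, and the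
    chain condition leaves only $rad^{d+1} M$. *)
Lemma above_rad_iter k L : chain_above (rad_iter M k) ->
  {subset rad_iter M k <= L} -> exists2 j, (j <= k)%N & L = rad_iter M j.
Proof.
move=> ch kL.
suff H d : (d <= k)%N -> (exists2 j, (j <= k)%N & L = rad_iter M j) \/
    {subset L <= rad_iter M d}.
  have [//|//|Lk] := H k; exists k => //; exact: sub_anti.
elim: d => [|d IHd] dk; first by right.
have [||Ld] := IHd; [exact: ltnW|by left|].
have [e|nLd] := pselect (L = rad_iter M d).
  by left; exists d => //; apply: ltnW.
right; have [K cK LK] := finlen_maximal fM Ld nLd.
have cd : covers (rad_iter M d.+1) (rad_iter M d).
  apply: (@rad_covers_chain k) => // e; apply: nLd.
  apply: sub_anti => //; rewrite e; exact: sub0.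
suff -> : rad_iter M d.+1 = K by [].
apply: (@covers_chain_uniq (rad_iter M k) (rad_iter M d)) => // x xk.
  exact: (@rad_iter_sub _ _ d.+1 k).
by apply/LK/kL.
Qed.

(** An [L] above [K] and incomparable with $rad^k M$ would give $rad^k M + L = rad^j M$ with $j <
    k$. As $rad^k M$ lies in the radical of $rad^j M$, superfluity forces $L = rad^j M$, which
    contains $rad^k M$. *)
Lemma chain_rad_next k K : chain_above (rad_iter M k) ->
  covers K (rad_iter M k) -> (forall K', covers K' (rad_iter M k) -> K' = K) ->
  chain_above K.
Proof.
move=> ch cK uK.
have cmp L : {subset K <= L} ->
    {subset rad_iter M k <= L} \/ {subset L <= rad_iter M k}.
  move=> KL; apply: contrapT => /not_orP[nkL nLk].
  have [|j jk ej] := @above_rad_iter k (addS (rad_iter M k) L) ch.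
    exact: addSl.
  have ltjk : (j < k)%N.
    rewrite ltn_neqAle jk andbT; apply/eqP => e; apply: nLk => x Lx.
    by rewrite -e -ej; apply: addSr.
  have eL : L = rad_iter M j.
    apply: rad_superfluous => // [x Lx|]; first by rewrite -ej; apply: addSr.
    rewrite -{1}ej => x /addSP[u uk Lxu]; apply/addSP; exists u => //.
    exact: (@rad_iter_sub _ _ j.+1 k).
  by apply: nkL => x; rewrite eL; apply: rad_iter_sub; apply: ltnW.
have [_ _ maxK] := cK.
move=> N L KN KL; have [kN|Nk] := cmp N KN; have [kL|Lk] := cmp L KL.
- exact: ch.
- by right=> x /Lk /kN.
- by left=> x /Nk /kL.
have [->|->] := maxK N KN Nk; first by left.
by right.
Qed.

Lemma two_maximal k : chain_above (rad_iter M k) ->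
  ~ chain_above (rad_iter M k.+1) ->
  exists K1 K2, [/\ covers K1 (rad_iter M k), covers K2 (rad_iter M k) & K1 <> K2].
Proof.
move=> ch nch.
have nz : rad_iter M k <> zero_submod M.
  move=> e; apply: nch; suff -> : rad_iter M k.+1 = rad_iter M k by [].
  apply: sub_anti; first exact: rad_sub.
  by rewrite e; apply: sub0.
have [|K cK _] := finlen_maximal fM (@sub0 _ _ (rad_iter M k)).
  exact/nesym.
apply: contrapT => nex; apply: nch.
have uK K' : covers K' (rad_iter M k) -> K' = K.
  by move=> cK'; apply: contrapT => ne; apply: nex; exists K', K.
suff -> : rad_iter M k.+1 = K by apply: chain_rad_next uK.
apply: sub_anti; first exact: rad_covers.
move=> x Kx; apply/radP; split; first exact: covers_sub Kx.
by move=> L /uK ->.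
Qed.

Lemma chain_local k : full_submod M <> zero_submod M ->
  chain_above (rad_iter M k) -> (0 < k)%N -> local M.
Proof.
move=> nz ch k0.
have [|K cK _] := finlen_maximal fM (@subT _ _ (zero_submod M)).
  exact/nesym.
exists K; split=> // L cL.
have radK H : covers H (full_submod M) -> {subset rad_iter M k <= H}.
  move=> cH x xk; apply: (rad_covers cH).
  exact: (@rad_iter_sub _ _ 1 k).
exact: (covers_chain_uniq ch (radK _ cK) (radK _ cL) cK cL).
Qed.

Lemma rad_iter_length l j : has_length M l ->
  rad_iter M j = zero_submod M \/
  exists2 m, clen (zero_submod M) (rad_iter M j) m & (m + j <= l)%N.
Proof.
move=> /has_lengthP c; elim: j => [|j IHj].
  by right; exists l; rewrite ?addn0.
have [e|nz] := pselect (rad_iter M j = zero_submod M).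
  left; apply: sub_anti; last exact: sub0.
  by rewrite -e; apply: rad_sub.
case: IHj => // -[m cm mj]; right.
have [m' cm' [_ lt]] := clen_lt cm (@sub0 _ _ (rad_iter M j.+1)) (@rad_sub _ _ _).
exists m' => //; rewrite addnS -addSn; apply: leq_trans mj.
by rewrite leq_add2r; apply: lt; apply: rad_neq.
Qed.

(** [k] is where uniseriality of the radical quotients stops. Two distinct maximal submodules of
    $rad^k M$ account for $k + 2 \le l$; for $k = 0$ they are maximal in [M], against locality. *)
Lemma factor_serial_index l : has_length M l -> ~ uniserial M ->
  exists k, [/\ (k.+2 <= l)%N, uniserial (quotmod (rad_iter M k)),
    ~ uniserial (quotmod (rad_iter M k.+1)) & local M -> (0 < k)%N].
Proof.
move=> hl nu.
have [k [ch nch]] : exists k, chain_above (rad_iter M k) /\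
    ~ chain_above (rad_iter M k.+1).
  apply: contrapT => nex; apply: nu; apply/uniserialP; split=> //.
  suff ch k : chain_above (rad_iter M k).
    suff e : rad_iter M l = zero_submod M by rewrite /total_submod -e.
    have [//|[m cm]] := rad_iter_length l hl.
    rewrite -[X in (_ <= X)%N]add0n leq_add2r leqn0 => /eqP e0.
    by rewrite e0 in cm; apply/esym/clen_zero.
  elim: k => [|k IHk]; first by left=> x _; auto.
  by apply: contrapT => nch; apply: nex; exists k.
have [K1 [K2 [c1 c2 n12]]] := two_maximal ch nch.
exists k; split.
- have [e|[m cm mk]] := rad_iter_length k hl.
    case: (c1) => s1 nK1 _; case: nK1; rewrite e in s1 *.
    by apply: sub_anti => //; apply: sub0.
  have [m1 cm1 [_ lt1]] := clen_lt cm (@sub0 _ _ K1) (covers_sub c1).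
  have nK1 : K1 <> rad_iter M k by case: c1.
  suff : (0 < m1)%N by move: (lt1 nK1) mk; case: m1 {cm1 lt1} => // m1; lia.
  case: m1 cm1 lt1 => // c0 _; have /esym e0 := clen_zero c0.
  case: (c2) (c1) => s2 ne2 _ [s1 ne1 max1].
  by case: (max1 K2) => // [|/esym//]; rewrite e0; apply: sub0.
- exact/quot_uniserial.
- by move/(quot_uniserial _ fM).
- move=> [K [_ uK]]; case: k ch nch c1 c2 => // _ _ c1 c2.
  by case: n12; rewrite -(uK _ c1) -(uK _ c2).
Qed.

End RadicalChain.

(** Since $i < l$, the uniserial quotient is by a positive radical power, and it already sees every
    maximal submodule of [M]. *)
Lemma factor_serial_local (A : pzRingType) (M : lmodType A) l i :
  full_submod M <> zero_submod M -> has_length M l -> (i < l)%N ->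
  factor_serial M i -> local M.
Proof.
move=> nz hl il; have fM : finlen M by exists l.
case: i il => [|[|i]] //= il.
  move/uniserialP=> [_ tot]; apply: (@chain_local _ _ fM 1) => // N K _ _.
  by apply: tot; apply: sub0.
move=> [_ [l' [hl' il' /(quot_uniserial _ fM) ch _]]].
have el : l' = l by apply: clen_uniq; [apply/has_lengthP; exact: hl'|exact/has_lengthP].
by apply: (chain_local fM nz ch); rewrite el subn_gt0.
Qed.

(** * A non-local indecomposable glued module *)

(* X is the fibre product of M / K2 and M / K1 over M / rad^j M: [phi] is the diagonal
   map of M and [y1] is the pair (0, v). *)
Section Gluing.
Variables (A : pzRingType) (M X : lmodType A).
Variables (phi : {linear M -> X}) (y1 : X) (v : M) (K1 K2 : submodClosed M) (j : nat).
Hypotheses (fM : finlen M) (fX : finlen X) (j0 : (0 < j)%N).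
Hypothesis ch : chain_above (rad_iter M j.+1).
Hypotheses (cK1 : covers K1 (rad_iter M j.+1)) (cK2 : covers K2 (rad_iter M j.+1)).
Hypothesis nK12 : K1 <> K2.
Hypotheses (vN : v \in rad_iter M j) (nvS : v \notin rad_iter M j.+1).
Hypothesis genX : forall x, exists m a, x = phi m + a *: y1.
Hypothesis relX : forall m a,
  phi m + a *: y1 = 0 <-> m \in K2 /\ m + a *: v \in K1.

Implicit Types N K L H : submodClosed M.

Let N0 := rad_iter M j.
Let S0 := rad_iter M j.+1.
Let D := meetS K1 K2.

Lemma phi_eq0 m : phi m = 0 <-> m \in D.
Proof.
split=> [e|/meetSP[m1 m2]].
  by have [] := relX m 0; rewrite !scale0r !addr0 => /(_ e)[? ?] _; apply/meetSP.
by have [_] := relX m 0; rewrite !scale0r !addr0; apply.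
Qed.

Lemma gen_eq0 a : a *: y1 = 0 <-> a *: v \in K1.
Proof.
have := relX 0 a; rewrite linear0 !add0r => -[r1 r2].
by split=> [/r1[]//|av]; apply: r2; rewrite rpred0.
Qed.

Lemma rad_addK : S0 = addS K1 K2.
Proof.
have [sK1 _ max1] := cK1; have [sK2 nK2 max2] := cK2.
case: (max1 (addS K1 K2)) => // [||e]; first exact: addSl.
  exact: addS_lub.
case: (max2 K1) => // [x|e1]; first by rewrite -e; apply: addSr.
by case: cK1 => _ [].
Qed.

Lemma S0_N0 : {subset S0 <= N0}. Proof. exact: rad_sub. Qed.

Lemma K1_S0 : {subset K1 <= S0}. Proof. exact: covers_sub cK1. Qed.
Lemma K2_S0 : {subset K2 <= S0}. Proof. exact: covers_sub cK2. Qed.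

Lemma not_K1_K2 : exists2 n, n \in K1 & n \notin K2.
Proof.
apply: notsub => K12; have [s1 n1 max1] := cK1.
by case: (max1 K2 K12 K2_S0) => e; [apply: nK12|case: cK2 => _ []].
Qed.

Lemma not_K2_K1 : exists2 n, n \in K2 & n \notin K1.
Proof.
apply: notsub => K21; have [s1 n1 max2] := cK2.
by case: (max2 K1 K21 K1_S0) => e; [apply: nK12|case: cK1 => _ []].
Qed.

Lemma N0_neq0 : N0 <> zero_submod M.
Proof.
by move=> e; case/negP: nvS; move: vN; rewrite -/N0 e => /eqP ->; apply: rpred0.
Qed.

Lemma S0_N0_covers : covers S0 N0.
Proof. by apply: (rad_covers_chain fM ch) => //; apply: N0_neq0. Qed.

Lemma N0_gen n : n \in N0 -> n \notin S0 -> forall m, m \in N0 -> exists a, m = a *: n.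
Proof.
move=> nN nS m mN; suff e : cyclicS n = N0 by apply/cyclicSP; rewrite e.
apply: rad_superfluous => //; first exact: cyclicS_sub.
exact: coversE S0_N0_covers nN nS.
Qed.

(** Writing $av = u + n$ with $u \in K_1$ and $n \in K_2$, the pair $(0, av)$ equals the diagonal
    element $(n, n)$. *)
Lemma glued a : a *: v \in S0 -> exists2 n, n \in K2 & a *: y1 = phi n.
Proof.
rewrite rad_addK => /addSP[u uK1 uK2]; exists (a *: v - u) => //.
apply/eqP; rewrite -subr_eq0 addrC -linearN; apply/eqP/relX.
by split; [apply: submN|rewrite opprB subrK].
Qed.

Lemma glue n a : n \in K2 -> n - a *: v \in K1 -> phi n = a *: y1.
Proof.
move=> n2 n1; apply/eqP; rewrite -subr_eq0 -scaleNr; apply/eqP/relX.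
by rewrite scaleNr.
Qed.

Lemma glued_S0 n a : phi n = a *: y1 -> n \in K2 /\ a *: v \in S0.
Proof.
move/eqP; rewrite -subr_eq0 -scaleNr => /eqP/relX[n2]; rewrite scaleNr => n1.
split=> //; rewrite rad_addK -(subKr n (a *: v)); apply: submB.
  exact: addSr.
exact: addSl.
Qed.

Lemma imS_phi n N : {subset D <= N} -> phi n \in imS phi N -> n \in N.
Proof.
move=> DN /imSP[m mN e]; rewrite -(subrK m n); apply: rpredD => //.
by apply/DN/phi_eq0; rewrite linearB e subrr.
Qed.

(** [phi] embeds $M/D$ into [X]. *)
Lemma imS_phi_covers K N : {subset D <= K} -> covers K N ->
  covers (imS phi K) (imS phi N).
Proof.
move=> DK [KN nKN maxK]; have DN : {subset D <= N} by move=> x /DK/KN.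
split=> [||L KL LN]; first exact: imS_mono.
  move=> e; apply: nKN; apply: sub_anti => // x xN; apply: imS_phi => //.
  by rewrite e imS_mem.
have eL : L = imS phi (preimS phi L).
  apply: sub_anti => x; last by case/imSP=> y; rewrite preimSP => ? ->.
  by move=> Lx; case/imSP: (LN _ Lx) (Lx) => y _ -> ?; rewrite imS_mem // preimSP.
case: (maxK (preimS phi L)) => [x xK|x|e|e].
- by rewrite preimSP; apply: KL; apply: imS_mem.
- by rewrite preimSP => /LN; apply: imS_phi.
- by left; rewrite eL e.
- by right; rewrite eL e.
Qed.

Let M1 := imS phi (full_submod M).
Let Q := imS phi (rad_iter M 1).

Lemma D_S0 : {subset D <= S0}. Proof. by move=> x /meetSP[/K1_S0]. Qed.

Lemma S0_rad i : (i <= j.+1)%N -> {subset S0 <= rad_iter M i}.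
Proof. exact: rad_iter_sub. Qed.

Lemma rad_iter_neq0 i : (i <= j)%N -> rad_iter M i <> zero_submod M.
Proof.
move=> ij e; apply: N0_neq0; apply: sub_anti; last exact: sub0.
by rewrite -e; apply: rad_iter_sub.
Qed.

Lemma QM1 : covers Q M1.
Proof.
apply: imS_phi_covers; first by move=> x /D_S0; apply: S0_rad.
by apply: (@rad_covers_chain _ _ fM j.+1 0) => //; apply: (@rad_iter_neq0 0).
Qed.

Lemma gen_notM1 : y1 \notin M1.
Proof.
apply/negP => /imSP[n _]; rewrite -[y1]scale1r => /esym/glued_S0[_].
by rewrite scale1r; apply/negP.
Qed.

Lemma gen_M1 a : a *: y1 \in M1 -> a *: v \in S0.
Proof. by move/imSP=> [n _ /esym/glued_S0[]]. Qed.

Lemma gen_S0_Q a : a *: v \in S0 -> a *: y1 \in Q.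
Proof.
case/glued=> n n2 ->; apply: imS_mem; apply: (@S0_rad 1) => //; exact: K2_S0.
Qed.

(** An element outside [M1] has a [y1]-coefficient [a] with $av \notin S_0$; then $v = cav$ for some
    [c], and $y_1$ is recovered as $c a y_1$ modulo zero. *)
Lemma M1X : covers M1 (full_submod X).
Proof.
split=> // [e|L ML _]; first by have := gen_notM1; rewrite e.
have [LM|/notsub[x Lx nMx]] := pselect {subset L <= M1}.
  by left; apply: sub_anti.
right; apply: sub_anti => // z _; have [m [a ex]] := genX x.
have Lay : a *: y1 \in L.
  by rewrite -(addKr (phi m) (a *: y1)) -ex addrC; apply: submB => //; apply/ML/imS_mem.
have naS : a *: v \notin S0.
  apply/negP => /glued[n _ e]; case/negP: nMx.
  by rewrite ex e -linearD imS_mem.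
have aN : a *: v \in N0 by apply: rpredZ.
have [c ec] := N0_gen aN naS vN.
have Ly : y1 \in L.
  rewrite -[y1](subrK (c *: (a *: y1))); apply: rpredD; last exact: rpredZ.
  apply: ML; rewrite scalerA -{1}[y1]scale1r -scalerBl.
  suff /gen_eq0 -> : (1 - c * a) *: v \in K1 by apply: rpred0.
  by rewrite scalerBl scale1r -scalerA -ec subrr rpred0.
have [m' [b ->]] := genX z; apply: rpredD; last exact: rpredZ.
by apply: ML; apply: imS_mem.
Qed.

(** A second maximal submodule of [X], meeting [M1] in [Q]. It witnesses that [X] is not local and
    pins the radical down to [Q]. *)
Let L1 := addS Q (cyclicS y1).

Lemma meetL1M1 : meetS L1 M1 = Q.
Proof.
rewrite modS; last exact: covers_sub QM1.
apply: add_eql => x /meetSP[/cyclicSP[a ->]] /gen_M1; exact: gen_S0_Q.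
Qed.

Lemma L1X : covers L1 (full_submod X).
Proof.
suff <- : addS L1 M1 = full_submod X.
  by apply: covers_add; rewrite meetL1M1; apply: QM1.
apply: sub_anti => // z _; have [m [a ->]] := genX z; apply: rpredD.
  by apply: addSr; apply: imS_mem.
by apply: addSl; apply: addSr; apply: rpredZ; apply: cyclicS_id.
Qed.

Lemma glued_nonlocal : ~ local X.
Proof.
move=> [K [_ uK]]; have := gen_notM1; rewrite -(uK _ M1X) (uK _ L1X).
by rewrite addSr ?cyclicS_id.
Qed.

Lemma rad_glued : rad (full_submod X) = Q.
Proof.
apply: sub_anti => x.
  move=> rx; rewrite -meetL1M1; apply/meetSP; split.
    exact: rad_covers L1X _ rx.
  exact: rad_covers M1X _ rx.
by move=> /rad_im; apply: rad_mono.
Qed.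

(** The chain $\phi(D) < \phi(K_2) < \phi(S_0) < \phi(N_0) \le Q < M_1 < X$ has five strict steps;
    $j > 0$ puts [N0] inside $rad M$. *)
Lemma glued_length l : has_length X l -> (5 <= l)%N.
Proof.
move=> /has_lengthP c; have [mu cmu] := clen_rank c.
have lt N K : {subset D <= K} -> {subset K <= N} -> K <> N ->
    (mu (imS phi K) < mu (imS phi N))%N.
  move=> DK KN nKN; apply: (clen_strict cmu); first exact: imS_mono.
  move=> e; apply: nKN; apply: sub_anti => // x xN; apply: imS_phi => //.
  by rewrite e imS_mem.
have DK2 : {subset D <= K2} by move=> x /meetSP[].
have h1 : (mu (imS phi D) < mu (imS phi K2))%N.
  apply: lt => // e; have [n n2 nn1] := not_K2_K1; case/negP: nn1.
  by move: n2; rewrite -e => /meetSP[].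
have h2 : (mu (imS phi K2) < mu (imS phi S0))%N.
  by case: cK2 => s2 n2 _; apply: lt.
have h3 : (mu (imS phi S0) < mu (imS phi N0))%N.
  by case: S0_N0_covers => s n _; apply: lt => //; apply: D_S0.
have h4 : (mu (imS phi N0) <= mu Q)%N.
  have [->//|ne] := pselect (N0 = rad_iter M 1).
  apply: ltnW; apply: lt => //; first by move=> x /D_S0/S0_N0.
  exact: rad_iter_sub.
have h5 : (mu Q < mu M1)%N.
  by case: QM1 => s n _; apply: (clen_strict cmu).
have h6 : (mu M1 < mu (full_submod X))%N.
  by case: M1X => s n _; apply: (clen_strict cmu).
rewrite (clen_uniq (cmu _) c) in h6.
by lia.
Qed.

(** If [Y] does not contain [Q], the elements of $rad M$ sent into [Y] lie in $rad^2 M$, the only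
    maximal submodule of $rad M$. Two such parts cannot sum to [Q]. *)
Lemma Q_hollow Y Z :
  {subset Q <= addS (meetS Q Y) (meetS Q Z)} -> {subset Q <= Y} \/ {subset Q <= Z}.
Proof.
move=> QYZ; have c21 : covers (rad_iter M 2) (rad_iter M 1).
  by apply: (rad_covers_chain fM ch) => //; apply: rad_iter_neq0.
have small (Y' : submodClosed X) : ~ {subset Q <= Y'} ->
    forall m, m \in rad_iter M 1 -> phi m \in Y' -> m \in rad_iter M 2.
  move=> nQY m m1 mY; have [||K cK UK] :=
      @finlen_maximal _ _ (meetS (rad_iter M 1) (preimS phi Y')) (rad_iter M 1) fM.
  - exact: meetSl.
  - move=> e; apply: nQY => _ /imSP[n + ->]; rewrite -e => /meetSP[_].
    by rewrite preimSP.
  suff -> : rad_iter M 2 = K by apply: UK; apply/meetSP; rewrite preimSP.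
  case: (c21) (cK) => _ _ max2 [sK nK _].
  by case: (max2 K) => //; apply: rad_covers.
apply: contrapT => /not_orP[nY nZ]; case: (c21) => _ []; apply: sub_anti.
  exact: rad_sub.
move=> x x1; apply: imS_phi; first by move=> y /D_S0; apply: S0_rad.
have /QYZ/addSP[_ /meetSP[/imSP[m m1 ->] mY] /meetSP[]] : phi x \in Q by apply: imS_mem.
rewrite -linearB => /imSP[n n1 e] nZ'; rewrite e in nZ'.
rewrite -(subrK (phi m) (phi x)) -linearB e -linearD; apply: imS_mem.
by apply: rpredD; [apply: small nZ'|apply: small mY].
Qed.

Section Summand.
Variables (Y Z : submodClosed X).
Hypotheses (YZ0 : forall x, x \in Y -> x \in Z -> x = 0).
Hypothesis YZ1 : forall x, exists u w, [/\ u \in Y, w \in Z & x = u + w].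

(** A maximal submodule [K] of [Y] extends to the maximal submodule $K + Z$ of [X], which meets [Y]
    in [K]. *)
Lemma rad_summand u w : u \in Y -> w \in Z -> u + w \in rad (full_submod X) ->
  u \in rad (full_submod X).
Proof.
move=> uY wZ ruw; apply: (@rad_mono _ _ Y) => //; apply/radP; split=> // K cK.
have eK : meetS (addS K Z) Y = K.
  rewrite modS; last exact: covers_sub cK.
  by apply: add_eql => x /meetSP[xZ xY]; rewrite (YZ0 xY xZ) rpred0.
have cX : covers (addS K Z) (full_submod X).
  suff <- : addS (addS K Z) Y = full_submod X by apply: covers_add; rewrite eK.
  apply: sub_anti => // x _; have [a [b [aY bZ ->]]] := YZ1 x.
  by apply: rpredD; [apply: addSr|apply/addSl/addSr].
have /addSP[k Kk] := rad_covers cX ruw; rewrite addrAC => ukZ.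
rewrite -[u](subrK k) (YZ0 (x := u - k)) ?add0r //.
  by apply: submB => //; apply: covers_sub Kk.
by rewrite -(addrK w (u - k)); apply: submB.
Qed.

End Summand.

Section SummandRad.
Variables (Y Z : submodClosed X).
Hypotheses (YZ0 : forall x, x \in Y -> x \in Z -> x = 0).
Hypothesis YZ1 : forall x, exists u w, [/\ u \in Y, w \in Z & x = u + w].
Hypothesis QY : {subset Q <= Y}.

(** If $av \notin S_0$, some multiple of $a y_1$ is $\phi(n)$ with $n \in K_2 \setminus K_1$, a
    nonzero element of both $Q \subseteq Y$ and [Z]. *)
Lemma gen_Z a : a *: y1 \in Z -> a *: v \in K1.
Proof.
move=> aZ; have [aS|naS] := boolP (a *: v \in S0).
  by apply/gen_eq0/YZ0 => //; apply/QY/gen_S0_Q.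
have aN : a *: v \in N0 by apply: rpredZ.
have [n n2 nn1] := not_K2_K1.
have [c ec] := N0_gen aN naS (S0_N0 (K2_S0 n2)).
have e : phi n = (c * a) *: y1.
  by apply: glue => //; rewrite -scalerA -ec subrr rpred0.
case/negP: nn1; suff /phi_eq0/meetSP[] : phi n = 0 by [].
apply: YZ0; last by rewrite e -scalerA rpredZ.
by apply/QY/imS_mem/(@S0_rad 1) => //; apply: K2_S0.
Qed.

Variables (u w : X).
Hypotheses (uY : u \in Y) (wZ : w \in Z) (y1E : y1 = u + w).

Lemma summand_eq0 a : a *: u = 0 <-> a *: v \in K1.
Proof.
split=> [e|/gen_eq0]; first by apply: gen_Z; rewrite y1E scalerDr e add0r rpredZ.
rewrite y1E scalerDr => /eqP; rewrite addr_eq0 => /eqP e; apply: YZ0.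
  exact: rpredZ.
by rewrite e -scalerN rpredZ // submN.
Qed.

(* The cyclic module generated by [u] is isomorphic to the uniserial module N0 / K1
   of length 2, while the image of S0 is a direct sum of two simple modules. *)
Lemma S0_notin_summand : u \notin imS phi S0 ->
  ~ {subset imS phi S0 <= cyclicS u}.
Proof.
move=> nuS Su; have [n1 n11 n12] := not_K1_K2; have [n2 n22 n21] := not_K2_K1.
have bound n a : n \in S0 -> phi n = a *: u -> a *: v \in S0.
  move=> nS e; apply: contrapT => /negP naS; case/negP: nuS.
  have aN : a *: v \in N0 by apply: rpredZ.
  have [c ec] := N0_gen aN naS vN.
  have /summand_eq0 : (1 - c * a) *: v \in K1.
    by rewrite scalerBl scale1r -scalerA -ec subrr rpred0.
  rewrite scalerBl scale1r => /eqP; rewrite subr_eq0 => /eqP ->.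
  by rewrite -scalerA -e -linearZ imS_mem ?rpredZ.
have /Su/cyclicSP[a1 e1] : phi n1 \in imS phi S0 by apply/imS_mem/K1_S0.
have /Su/cyclicSP[a2 e2] : phi n2 \in imS phi S0 by apply/imS_mem/K2_S0.
have a1S := bound _ _ (K1_S0 n11) e1; have a2S := bound _ _ (K2_S0 n22) e2.
have a1K : a1 *: v \notin K1.
  apply/negP => /summand_eq0 e0; case/negP: n12.
  by suff /phi_eq0/meetSP[] : phi n1 = 0 by []; rewrite e1.
have /addSP[k Kk /cyclicSP[c ec]] := coversE cK1 a1S a1K a2S.
have : (a2 - c * a1) *: v \in K1.
  by rewrite scalerBl -scalerA -ec subKr.
move/summand_eq0; rewrite scalerBl -scalerA -e1 -e2 -linearZ -linearB.
move/phi_eq0/meetSP=> [n2c _]; case/negP: n21.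
by rewrite -(subrK (c *: n1) n2); apply: rpredD => //; apply: rpredZ.
Qed.

(** If $u = \phi(s)$, then $bv \mapsto bs$ maps [N0] to the semisimple module $S_0/D$ and so kills
    [S0], whereas the annihilator of [u] allows only [K1] to be killed. *)
Lemma summand_notin_S0 : u \notin imS phi S0.
Proof.
apply/negP => /imSP[s sS eu].
have [n n2 nn1] := not_K2_K1.
have [a ea] := N0_gen vN nvS (S0_N0 (K2_S0 n2)).
have aS : a *: v \in S0 by rewrite -ea; apply: K2_S0.
suff ker (K : submodClosed M) : covers K S0 -> {subset D <= K} -> a *: s \in K.
  case/negP: nn1; rewrite ea; apply/summand_eq0; rewrite eu -linearZ.
  apply/phi_eq0/meetSP; split; apply: ker => // x /meetSP[] //.
move=> cK DK.
(* G is the kernel of N0 -> S0 / K, b v |-> b s, hence is maximal or equal to N0. *)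
pose P x := exists2 b, x = b *: v & b *: s \in K.
have P0 : P 0 by exists 0; rewrite ?scale0r ?rpred0.
have PD c x y : P x -> P y -> P (c *: x + y).
  move=> [b -> bK] [b' -> b'K]; exists (c * b + b'); first by rewrite scalerDl scalerA.
  by rewrite scalerDl -scalerA rpredD // rpredZ.
have wd b b' : b *: v = b' *: v -> b *: s \in K -> b' *: s \in K.
  move=> e bK; rewrite -(subKr (b *: s) (b' *: s)); apply: submB => //.
  apply: DK; apply/phi_eq0; rewrite -scalerBl linearZ -eu; apply/summand_eq0.
  by rewrite scalerBl e subrr rpred0.
suff : a *: v \in mksub P0 PD by case/mksubP=> b /esym e; apply: wd.
have GN : {subset mksub P0 PD <= N0}.
  by move=> x /mksubP[b -> _]; apply: rpredZ.
have [->|nGN] := pselect (mksub P0 PD = N0); first exact: S0_N0.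
apply: (rad_covers (N := N0)) => //; split=> // L GL LN.
have [LG|/notsub[x Lx /mksubP nGx]] := pselect {subset L <= mksub P0 PD}.
  by left; apply: sub_anti.
right; apply: sub_anti => // y yN.
have [b eb] := N0_gen vN nvS yN; have [c ec] := N0_gen vN nvS (LN _ Lx).
have csK : c *: s \notin K by apply/negP => ?; apply: nGx; exists c.
have /addSP[k Kk /cyclicSP[d ed]] :=
  coversE cK (rpredZ c sS) csK (rpredZ b sS).
rewrite -(subrK (d *: x) y); apply: rpredD; last exact: rpredZ.
apply: GL; apply/mksubP; exists (b - d * c).
  by rewrite scalerBl -scalerA -ec -eb.
by rewrite scalerBl -scalerA -ed subKr.
Qed.

Lemma summand_eq_zero : Z = zero_submod X.
Proof.
apply: contrapT => nZ0; apply: (S0_notin_summand summand_notin_S0).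
have S0Q : {subset imS phi S0 <= Q} by apply/imS_mono/S0_rad.
(* If $u = \phi(n)$ lies in [Q], then $n \notin S_0$, so $S_0 + An$ is a radical power containing
   [N0]; superfluity of [S0] in [N0] gives $N_0 \subseteq An$. *)
have [/imSP[n n1 eu]|nuQ] := boolP (u \in Q).
  have nnS : n \notin S0.
    by apply/negP => nS; case/negP: summand_notin_S0; rewrite eu imS_mem.
  have [|i ij ei] := @above_rad_iter _ _ fM j.+1 (addS S0 (cyclicS n)) ch.
    exact: addSl.
  have {}ij : (i <= j)%N.
    rewrite -ltnS ltn_neqAle ij andbT; apply/eqP => e; case/negP: nnS.
    by rewrite /S0 -e -ei addSr ?cyclicS_id.
  have eN : meetS (cyclicS n) N0 = N0.
    apply: rad_superfluous => //; first exact: meetSr.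
    rewrite -modS; last exact: S0_N0.
    by move=> x xN; apply/meetSP; split=> //; rewrite ei; apply: rad_iter_sub xN.
  move=> _ /imSP[x /S0_N0 + ->]; rewrite -eN => /meetSP[/cyclicSP[a ->] _].
  by rewrite linearZ -eu rpredZ ?cyclicS_id.
(* Since $X/Q$ has length 2 and [Y] is proper, $Q + Au$ already fills [Y]. Then $Au + Z$ is [X]
   modulo the radical, hence all of [X], and $Y = Au$. *)
suff eY : addS Q (cyclicS u) = Y.
  have eX : addS (cyclicS u) Z = full_submod X.
    apply: rad_superfluous => // x _; rewrite rad_glued.
    have [a [b [aY bZ ->]]] := YZ1 x; apply: rpredD; last by apply/addSr/addSr.
    move: aY; rewrite -eY; apply: addS_lub; first exact: addSl.
    by move=> z zu; apply/addSr/addSl.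
  move=> x /S0Q/QY xY; have : x \in addS (cyclicS u) Z by rewrite eX.
  case/addSP=> z zu xzZ; rewrite -(subrK z x) (YZ0 (x := x - z)) ?add0r //.
  by apply: submB => //; apply: (cyclicS_sub uY).
have c2 : clen Q (full_submod X) 2 by apply: clenS QM1 (clen1 M1X).
have QuY : {subset addS Q (cyclicS u) <= Y} by apply: addS_lub => //; apply: cyclicS_sub.
apply: contrapT => nQuY.
have [l2 cl2 [_ lt2]] := clen_lt c2 QY (@subT _ _ Y).
have [l1 cl1 [_ lt1]] := clen_lt cl2 (@addSl _ _ Q (cyclicS u)) QuY.
have nYX : Y <> full_submod X.
  move=> eYX; apply: nZ0; apply: sub_anti; last exact: sub0.
  by move=> x xZ; rewrite (YZ0 _ xZ) ?rpred0 // eYX.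
have := lt1 nQuY; have := lt2 nYX.
case: l1 cl1 {lt1} => [cl1|l1 _]; last by lia.
by case/negP: nuQ; rewrite (clen_zero cl1) addSr ?cyclicS_id.
Qed.

End SummandRad.

Lemma glued_indecomposable : indecomposable X.
Proof.
split=> [e|Y Z YZ0 YZ1].
  have := gen_notM1; have : y1 \in full_submod X by [].
  by rewrite e => /eqP ->; rewrite rpred0.
have ZY0 x : x \in Z -> x \in Y -> x = 0 by move=> ? ?; apply: YZ0.
have ZY1 x : exists a b, [/\ a \in Z, b \in Y & x = a + b].
  by have [a [b [? ? ->]]] := YZ1 x; exists b, a; split=> //; rewrite addrC.
have [|QY|QZ] := @Q_hollow Y Z.
- move=> x; rewrite -rad_glued => rx; have [a [b [aY bZ ex]]] := YZ1 x.
  rewrite ex in rx *; apply: rpredD; [apply: addSl|apply: addSr]; apply/meetSP.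
    by split=> //; apply: (rad_summand YZ0 YZ1 aY bZ rx).
  by split=> //; rewrite addrC in rx; apply: (rad_summand ZY0 ZY1 bZ aY rx).
- by right; have [a [b [aY bZ e]]] := YZ1 y1; apply: (summand_eq_zero YZ0 YZ1 QY aY bZ e).
- by left; have [a [b [aZ bY e]]] := ZY1 y1; apply: (summand_eq_zero ZY0 ZY1 QZ aZ bY e).
Qed.

End Gluing.

(** * Finite generation and construction of the glued module *)

Section Generation.
Variables (A : pzRingType) (M : lmodType A).

Definition generates (s : seq M) := forall K : submodClosed M,
  {subset s <= K} -> forall x, x \in K.

Lemma fg_generates : finitely_generated M <-> exists s, generates s.
Proof.
split=> [[n [g gM]]|[s gs]].
  exists (codom g) => K gK x; have [a ->] := gM x.
  by apply: rpred_sum => i _; apply: rpredZ; apply: gK; apply: codom_f.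
exists (size s), (fun i => s`_i).
pose P x := exists a : 'I_(size s) -> A, x = \sum_(i < size s) a i *: s`_i.
have P0 : P 0.
  by exists (fun=> 0); rewrite big1 // => i _; rewrite scale0r.
have PD c x y : P x -> P y -> P (c *: x + y).
  move=> [a ->] [b ->]; exists (fun i => c * a i + b i).
  rewrite scaler_sumr -big_split; apply: eq_bigr => i _ /=.
  by rewrite scalerDl scalerA.
move=> x; apply/(mksubP P0 PD); apply: gs => y /(nthP 0)[i lt_i <-].
apply/mksubP; exists (fun k => (k == Ordinal lt_i)%:R).
rewrite (bigD1 (Ordinal lt_i)) //= eqxx scale1r big1 ?addr0 // => k nk.
by rewrite (negPf nk) scale0r.
Qed.

Definition smul (x : M) (a : A^o) : M := (a : A) *: x.

Lemma smul_linear x : linear (smul x).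
Proof. by move=> a b c; rewrite /smul scalerA -scalerDl. Qed.

HB.instance Definition _ x :=
  GRing.isLinear.Build A A^o M _ (smul x) (smul_linear x).

(** Add one generator [x] at a time: submodules between [N] and $N + Ax$ are determined by their
    preimages under $a \mapsto ax$, so a rank on [A] pulls back to this interval. *)
Lemma fg_finlen : finlen A^o -> finitely_generated M -> finlen M.
Proof.
move=> /finlen_rank[mu smu] /fg_generates[s gs].
suff [N [l c sN]] : exists N : submodClosed M, exists2 l,
    clen (zero_submod M) N l & {subset s <= N}.
  exists l; apply/has_lengthP; suff <- : N = full_submod M by [].
  by apply: sub_anti => // x _; apply: gs.
elim: s {gs} => [|x s [N [l c sN]]].
  by exists (zero_submod M), 0 => //; apply: clen0.
exists (addS N (cyclicS x)).
suff [l' c'] : exists l', clen N (addS N (cyclicS x)) l'.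
  exists (l + l')%N; first exact: clen_trans c c'.
  move=> y; rewrite inE => /orP[/eqP ->|/sN]; last exact: addSl.
  by apply/addSr/cyclicS_id.
apply: (@rank_clen _ _ (fun K => mu (preimS (smul x) K))); last exact: addSl.
move=> L H NL LH HN nLH; apply: smu => [||//|e]; first exact: sub0.
  by move=> a; rewrite !preimSP; apply: LH.
apply: nLH; apply: sub_anti => // y Hy.
have /addSP[n Nn /cyclicSP[a ea]] := HN _ Hy.
have nL := NL _ Nn.
rewrite -(subrK n y); apply: rpredD => //; rewrite ea.
have : (a : A^o) \in preimS (smul x) H by rewrite preimSP /= /smul -ea submB // LH.
by rewrite -e preimSP.
Qed.

End Generation.

Lemma fg_surj (A : pzRingType) (M Q : lmodType A) (f : {linear M -> Q}) :
  (forall y, exists x, f x = y) -> finitely_generated M -> finitely_generated Q.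
Proof.
move=> sf [n [g gM]]; exists n, (f \o g) => y; have [x <-] := sf y.
have [a ->] := gM x; exists a; rewrite linear_sum; apply: eq_bigr => i _.
by rewrite linearZ.
Qed.

Lemma fg_prod (A : pzRingType) (M N : lmodType A) :
  finitely_generated M -> finitely_generated N ->
  finitely_generated ((M * N)%type : lmodType A).
Proof.
move=> /fg_generates[s gs] /fg_generates[t gt]; apply/fg_generates.
exists ([seq (x, 0) | x <- s] ++ [seq (0, y) | y <- t]) => K stK [x y].
rewrite -[x]addr0 -[y in (_, y)]add0r -[(_, _)]/((x, 0) + (0, y)).
apply: rpredD.
  have P0 : (0, 0) \in K by apply: rpred0.
  have PD a (u w : M) : (u, 0) \in K -> (w, 0) \in K -> (a *: u + w, 0) \in K.
    move=> Ku Kw; have := rpredD (rpredZ a Ku) Kw.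
    by congr (_ \in K); congr pair; rewrite /= scaler0 addr0.
  apply/(mksubP P0 PD); apply: gs => u us; apply/mksubP/stK.
  by rewrite mem_cat map_f.
have P0 : (0, 0) \in K by apply: rpred0.
have PD a (u w : N) : (0, u) \in K -> (0, w) \in K -> (0, a *: u + w) \in K.
  move=> Ku Kw; have := rpredD (rpredZ a Ku) Kw.
  by congr (_ \in K); congr pair; rewrite /= scaler0 addr0.
apply/(mksubP P0 PD); apply: gt => u us; apply/mksubP/stK.
by rewrite mem_cat map_f ?orbT.
Qed.

Section GluedModule.
Variables (A : pzRingType) (M : lmodType A).
Variables (v : M) (K1 K2 : submodClosed M).

(** Kernel of $(m, a) \mapsto (m + K_2, m + av + K_1)$ on $M \oplus A$, whose image is the fibre
    product over $M/Av$. *)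
Definition glue_rel : submodClosed (M * A^o)%type.
Proof.
apply: (@mksub A (M * A^o)%type (fun p => p.1 \in K2 /\ p.1 + (p.2 : A) *: v \in K1)).
  by rewrite scale0r addr0 !rpred0.
move=> a [m b] [n c] [/= m2 m1] [/= n2 n1]; split=> /=; first by rewrite rpredD ?rpredZ.
rewrite scalerDl -scalerA addrACA -scalerDr; by rewrite rpredD ?rpredZ.
Defined.

Definition glue_mod : lmodType A := quotmod glue_rel.

Definition glue_phi (m : M) : glue_mod := piQ glue_rel (m, 0).

Lemma glue_phi_linear : linear glue_phi.
Proof.
move=> a x y; rewrite /glue_phi -linearP; congr (piQ _ (_, _)).
by rewrite /= scaler0 addr0.
Qed.

HB.instance Definition _ :=
  GRing.isLinear.Build A M glue_mod _ glue_phi glue_phi_linear.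

End GluedModule.

Lemma fg_regular (A : pzRingType) : finitely_generated A^o.
Proof.
exists 1, (fun=> 1) => x; exists (fun=> x).
by rewrite big_ord1 /= -[_ *: _]/(x * 1) mulr1.
Qed.

Lemma exists_glued (A : pzRingType) (M : lmodType A) (K1 K2 : submodClosed M) k :
  finlen A^o -> finitely_generated M -> (1 < k)%N -> chain_above (rad_iter M k) ->
  covers K1 (rad_iter M k) -> covers K2 (rad_iter M k) -> K1 <> K2 ->
  exists X : lmodType A, [/\ finitely_generated X, indecomposable X, ~ local X &
    forall l, has_length X l -> (5 <= l)%N].
Proof.
move=> fA fgM; case: k => // j j0 ch c1 c2 nK12; rewrite ltnS in j0.
have fM := fg_finlen fA fgM.
have [v vN nvS] : exists2 v, v \in rad_iter M j & v \notin rad_iter M j.+1.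
  apply: notsub => NS; have eNS : rad (rad_iter M j) = rad_iter M j.
    by apply: sub_anti => //; apply: rad_sub.
  have [e|ne] := pselect (rad_iter M j = zero_submod M); last exact: (rad_neq fM ne).
  case: (c1) => s1 + _; apply; apply: sub_anti => // x.
  by rewrite -[rad_iter M j.+1]/(rad (rad_iter M j)) eNS e; apply: sub0.
pose X := glue_mod v K1 K2; pose y1 : X := piQ (glue_rel v K1 K2) (0, 1).
have glueE m a : glue_phi v K1 K2 m + a *: y1 = piQ (glue_rel v K1 K2) (m, a).
  rewrite /y1 /glue_phi -linearZ -linearD /=; congr (piQ _ (_, _)).
    by rewrite /= scaler0 addr0.
  by rewrite /= add0r -[_ *: _]/(a * 1) mulr1.
have genX x : exists m a, x = glue_phi v K1 K2 m + a *: y1.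
  by have [[m a] <-] := piQ_surj x; exists m, a; rewrite glueE.
have relX m a :
    glue_phi v K1 K2 m + a *: y1 = 0 <-> m \in K2 /\ m + a *: v \in K1.
  rewrite glueE; split; first by move/eqP; rewrite piQ_eq0 => /mksubP.
  by move=> ma; apply/eqP; rewrite piQ_eq0; apply/mksubP.
have fgX : finitely_generated X.
  apply: fg_surj (@piQ_surj _ _ (glue_rel v K1 K2)) _.
  by apply: fg_prod => //; apply: fg_regular.
have fX := fg_finlen fA fgX.
exists X; split=> //.
- exact: glued_indecomposable fM fX j0 ch c1 c2 nK12 vN nvS genX relX.
- exact: glued_nonlocal fM ch c1 c2 nK12 vN nvS genX relX.
- exact: glued_length fM j0 ch c1 c2 nK12 vN nvS genX relX.
Qed.

(** * Finite length over artin algebras *)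

Section ArtinianLength.
Variable R : comPzRingType.
Hypothesis artR : artinian R.
Implicit Types N K L H : submodClosed R^o.

Definition finlenS N := exists l, clen (zero_submod R^o) N l.

Lemma artinian_minimal (P : submodClosed R^o -> Prop) : (exists N, P N) ->
  exists2 N, P N & forall K, {subset K <= N} -> K <> N -> ~ P K.
Proof.
move=> [N0 PN0]; apply: contrapT => nex.
have step (N : {N | P N}) : exists K : {N | P N},
    {subset sval K <= sval N} /\ sval K <> sval N.
  apply: contrapT => nK; apply: nex; exists (sval N); first exact: svalP.
  by move=> K KN ne PK; apply: nK; exists (exist _ K PK).
have [g gP] := boolp.choice step.
pose I n := sval (iter n g (exist _ N0 PN0)).
have [n|n stab] := artR (I := I); first by have [] := gP (iter n g (exist _ N0 PN0)).
have [_] := gP (iter n g (exist _ N0 PN0)); apply.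
exact: (stab n.+1 (leqnSn n)).
Qed.

(** Once [N] is known to be a vector space, this gives a hyperplane avoiding [w]; Zorn's lemma
    stands in for a finite basis. *)
Lemma avoiding_maximal N (w : R^o) : w != 0 ->
  exists2 H : submodClosed R^o, {subset H <= N} & w \notin H /\
    forall L, {subset H <= L} -> {subset L <= N} -> w \notin L -> L = H.
Proof.
move=> w0.
pose P (S : set R^o) := [/\ forall a x y, S x -> S y -> S (a *: x + y : R^o),
  forall x, S x -> x \in N & ~ S w].
have [|S [[SD SN nSw] maxS]] := @Zorn_bigcup R^o P.
  move=> F FP totF; split=> [a x y [S FS Sx] [T FT Ty]|x [S /FP[_ SN _] /SN]//|].
    have [ST|TS] := totF S T FS FT.
      by exists T => //; have [TD _ _] := FP _ FT; apply: TD => //; apply: ST.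
    by exists S => //; have [SD _ _] := FP _ FS; apply: SD => //; apply: TS.
  by move=> [S /FP[_ _ nSw]].
(* [P] omits $0 \in S$ so that the union of the empty chain qualifies. A maximal [S] without $0$
   would be empty, and $\{0\}$ would exceed it. *)
have S0 : S 0.
  apply: contrapT => nS0; apply: (maxS [set 0]%classic); last first.
    split=> [a x y -> ->|x ->|/eqP]; first by rewrite scaler0 addr0.
      exact: rpred0.
    by rewrite (negPf w0).
  have nS x : ~ S x.
    move=> Sx; apply: nS0; have := SD (-1) x x Sx Sx.
    by rewrite scaleN1r addNr.
  by split=> [x /nS //|/(_ 0 erefl)/nS0].
exists (mksub S0 SD) => [x /mksubP/SN//|]; split; first exact/mksubP.
move=> L HL LN nwL; apply: sub_anti => // x Lx; apply: contrapT => nSx.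
apply: (maxS [set y | y \in L]%classic); last first.
  split=> [a y z|y|]; [|exact: LN|exact/negP].
  by move=> Ly Lz; rewrite /=; apply: rpredD => //; apply: rpredZ.
split=> [y Sy|/(_ x Lx) Sx]; last by apply: nSx; apply/mksubP.
by apply: HL; apply/mksubP.
Qed.

Definition mulSl (r : R) N : submodClosed R^o.
Proof.
apply: (@mksub _ R^o (fun y => exists2 x, x \in N & y = r * x :> R)).
  by exists 0; rewrite ?rpred0 ?mulr0.
move=> a _ _ [x Nx ->] [y Ny ->]; exists (a *: x + y); first by rewrite rpredD ?rpredZ.
by rewrite mulrDr; congr (_ + _); rewrite -[RHS]/(r * (a * x)) mulrCA.
Defined.

(** Take [N] minimal among the ideals of infinite length. It turns out to be a vector space, and a
    hyperplane in it, being proper, has finite length: then so has [N]. *)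
Lemma artinian_finlen : finlen R^o.
Proof.
apply: contrapT => nfin.
have [|N nN minN] := @artinian_minimal (fun N => ~ finlenS N).
  by exists (full_submod R^o) => -[l c]; apply: nfin; exists l; apply/has_lengthP.
have {}minN K : {subset K <= N} -> K <> N -> finlenS K.
  by move=> KN ne; apply: contrapT; apply: minN.
have mulS_sub r : {subset mulSl r N <= N}.
  by move=> _ /mksubP[x Nx ->]; apply: (@rpredZ _ _ N r).
(* r N is either 0 or N: otherwise r N and the kernel of r on N are proper. *)
have dich r : mulSl r N = N \/ forall x, x \in N -> r * x = 0.
  have [|ne] := pselect (mulSl r N = N); first by left.
  right; pose P (x : R^o) := x \in N /\ r * x = 0.
  have P0 : P 0 by split; rewrite ?rpred0 ?mulr0.
  have PD a x y : P x -> P y -> P (a *: x + y).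
    move=> [Nx rx] [Ny ry]; split; first by rewrite rpredD ?rpredZ.
    by rewrite mulrDr ry addr0 -[r * _]/(r * (a * x)) mulrCA rx mulr0.
  have KN : {subset mksub P0 PD <= N} by move=> x /mksubP[].
  have [e x|neK] := pselect (mksub P0 PD = N).
    by rewrite -e => /mksubP[].
  case: nN; have [l c] := minN _ KN neK.
  have [m cm] := minN _ (@mulS_sub r) ne.
  have [mu cmu] : exists mu : submodClosed R^o -> nat, forall L,
      {subset L <= N} -> clen (zero_submod R^o) (mulSl r L) (mu L).
    suff /boolp.choice[mu cmu] L : exists m, {subset L <= N} ->
      clen (zero_submod R^o) (mulSl r L) m by exists mu.
    have [LN|nLN] := pselect {subset L <= N}; last by exists 0.
    have [|k ck _] := clen_lt cm (@sub0 _ _ (mulSl r L)); last by exists k.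
    by move=> _ /mksubP[x Lx ->]; apply/mksubP; exists x => //; apply: LN.
  have [|l' c'] := @rank_clen _ _ mu (mksub P0 PD) N _ KN; last first.
    by exists (l + l')%N; apply: clen_trans c c'.
  move=> L H KL LH HN nLH; have LN : {subset L <= N} by move=> x /LH /HN.
  have LHs : {subset mulSl r L <= mulSl r H}.
    by move=> _ /mksubP[x Lx ->]; apply/mksubP; exists x => //; apply: LH.
  have [k ck [_ lt]] := clen_lt (cmu _ HN) (@sub0 _ _ (mulSl r L)) LHs.
  rewrite (clen_uniq (cmu _ LN) ck); apply: lt => e.
  apply: nLH; apply: sub_anti => // y Hy.
  have : (r * y : R^o) \in mulSl r L by rewrite e; apply/mksubP; exists y.
  case/mksubP=> z Lz ez; rewrite -(subrK z y); apply: rpredD => //.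
  apply: KL; apply/mksubP; split; first by apply: submB; [apply: HN|apply: LN].
  by rewrite mulrBr ez subrr.
(* Hence N is a vector space over a field, the ring modulo the annihilator of N. *)
have inv c z : z \in N -> c * z != 0 -> exists s, forall x, x \in N -> s * (c * x) = x.
  move=> Nz cz0.
  have cN : mulSl c N = N by case: (dich c) => // /(_ z Nz) e; rewrite e eqxx in cz0.
  have cnN n x : x \in N -> exists2 y, y \in N & x = c ^+ n * y.
    elim: n x => [|n IHn] x Nx; first by exists x; rewrite ?expr0 ?mul1r.
    have [y Ny ->] := IHn x Nx; rewrite -cN in Ny; case/mksubP: Ny => t Nt ->.
    by exists t; rewrite ?exprSr ?mulrA.
  (* Stabilization gives $c^n = s c^{n+1}$. As $cN = N$, every [x] in [N] has the form $c^n y$, so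
     [s] inverts [c] on [N]. *)
  have [n x|n stab] := artR (I := fun n => cyclicS (c ^+ n : R^o)).
    case/cyclicSP=> a ->; rewrite exprSr -[_ *: _]/(a * (c ^+ n * c)) mulrA mulrAC.
    by apply/cyclicSP; exists (a * c); rewrite -[RHS]/(a * c * c ^+ n).
  have : (c ^+ n : R^o) \in cyclicS (c ^+ n.+1 : R^o).
    by rewrite (stab n.+1 (leqnSn n)) cyclicS_id.
  case/cyclicSP=> s es; exists s => x Nx; have [y Ny ->] := cnN n x Nx.
  by rewrite [in RHS]es -[_ *: _]/(s * c ^+ n.+1) exprS !mulrA.
have [w Nw w0] : exists2 w, w \in N & w != 0.
  apply: contrapT => nex; apply: nN; exists 0.
  suff -> : N = zero_submod R^o by apply: clen0.
  apply: sub_anti; last exact: sub0.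
  by move=> x Nx; apply: contrapT => /negP x0; apply: nex; exists x.
have [H HN [nwH maxH]] := avoiding_maximal N w0.
have nHN : H <> N by move=> e; rewrite e Nw in nwH.
have [l c] := minN H HN nHN; apply: nN; exists (l + 1)%N.
apply: clen_trans c (clen1 _); split=> // L HL LN.
have [wL|nwL] := boolP (w \in L); last by left; apply: maxH.
right; apply: sub_anti => // x Nx.
have [Hx|nHx] := boolP (x \in H); first exact: HL.
have wHx : w \in addS H (cyclicS x).
  apply: contrapT => /negP nw; case/negP: nHx.
  rewrite -(maxH (addS H (cyclicS x)) (@addSl _ _ _ _)) //.
    by apply/addSr/cyclicS_id.
  by apply: addS_lub => //; apply: cyclicS_sub.
case/addSP: wHx => h Hh /cyclicSP[a ea].
have [|s sP] := inv a x Nx.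
  rewrite -[a * x]/(a *: (x : R^o)) -ea subr_eq0; apply: contraNneq nwH => -> //.
rewrite -(sP x Nx) -[a * x]/(a *: (x : R^o)) -ea.
by apply: (@rpredZ _ _ L s); apply: submB => //; apply: HL.
Qed.

End ArtinianLength.

Section ArtinAlgebra.
Variables (R : comPzRingType) (Lambda : algType R).
Hypothesis artL : artin_algebra Lambda.

Lemma artin_algebra_finlenR : finlen (Lambda : lmodType R).
Proof. by case: artL => /artinian_finlen fR fg; apply: fg_finlen. Qed.

Lemma artin_algebra_finlen_left : finlen Lambda^o.
Proof.
have [mu smu] := finlen_rank artin_algebra_finlenR.
have P0 (K : submodClosed Lambda^o) : (0 : Lambda) \in K by apply: rpred0.
have PD (K : submodClosed Lambda^o) (r : R) (x y : Lambda) :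
    x \in K -> y \in K -> r *: x + y \in K.
  move=> Kx Ky; rewrite -[x]mul1r scalerAl.
  by apply: (rpredD (rpredZ (r%:A : Lambda) Kx) Ky).
apply: (@rank_finlen _ _ (fun K => mu (mksub (P0 K) (PD K)))).
move=> L H _ LH _ nLH; apply: smu => [|x /mksubP Lx||e]; [exact: sub0| |by []|].
  by apply/mksubP; apply: LH.
apply: nLH; apply: sub_anti => // x Hx.
have : (x : Lambda) \in mksub (P0 H) (PD H) by apply/mksubP.
by rewrite -e => /mksubP.
Qed.

Lemma artin_algebra_finlen_right : finlen (Lambda^c)^o.
Proof.
have [mu smu] := finlen_rank artin_algebra_finlenR.
have P0 (K : submodClosed (Lambda^c)^o) : (0 : Lambda) \in K by apply: rpred0.
have PD (K : submodClosed (Lambda^c)^o) (r : R) (x y : Lambda) :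
    x \in K -> y \in K -> r *: x + y \in K.
  move=> Kx Ky; rewrite -[x]mulr1 scalerAr.
  by apply: (rpredD (rpredZ (r%:A : Lambda^c) Kx) Ky).
apply: (@rank_finlen _ _ (fun K => mu (mksub (P0 K) (PD K)))).
move=> L H _ LH _ nLH; apply: smu => [|x /mksubP Lx||e]; [exact: sub0| |by []|].
  by apply/mksubP; apply: LH.
apply: nLH; apply: sub_anti => // x Hx.
have : (x : Lambda) \in mksub (P0 H) (PD H) by apply/mksubP.
by rewrite -e => /mksubP.
Qed.

End ArtinAlgebra.

(** * Local idempotents and two-generated modules *)

(* B plays the role of A^c: its products are reversed with respect to the header. *)
Section ChainIdempotents.
Variable B : pzRingType.
Implicit Types a b c d e f g u v w : B.

(** Uniseriality of the left module $Bf$ in elementwise form: its cyclic submodules are pairwise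
    comparable. *)
Definition chain_idem f := [/\ f * f = f, f != 0 &
  forall u v, (exists w, u * f = w * (v * f)) \/ (exists w, v * f = w * (u * f))].

(** For [d] in the corner ring $eBe$, this is invertibility there. *)
Definition corner_unit e d := exists d', [/\ e * d' = d', d' * e = d',
  d' * d = e & d * d' = e].

Definition comparable a b := (exists w, a = b * w) \/ (exists w, b = a * w).

(** Of the orthogonal idempotents [g] and $f - g$ one is a left multiple of the other; multiplying
    it by itself then gives zero. *)
Lemma chain_idem_trivial f g : chain_idem f -> g * g = g -> f * g = g ->
  g * f = g -> g = 0 \/ g = f.
Proof.
move=> [ff f0 ch] gg fg gf.
have gfg : g * (f - g) = 0 by rewrite mulrBr gf gg subrr.
have fgg : (f - g) * g = 0 by rewrite mulrBl fg gg subrr.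
have fgf : (f - g) * f = f - g by rewrite mulrBl ff gf.
have [[w]|[w]] := ch g (f - g); rewrite gf fgf => e.
  by left; rewrite -gg [X in X * _]e -mulrA fgg mulr0.
have fgfg : f - g = (f - g) * (f - g) by rewrite [RHS]mulrBr fgf fgg subr0.
right; apply/esym/eqP; rewrite -subr_eq0 fgfg {1}e -mulrA gfg mulr0 //.
Qed.

(** $wc$ is an idempotent of $gBg$, hence $0$ or [g], and $f = c(wc)w$ excludes $0$. *)
Lemma chain_idem_swap f g c w : chain_idem f -> chain_idem g ->
  f * c = c -> c * g = c -> g * w = w -> w * f = w -> c * w = f -> w * c = g.
Proof.
move=> [ff f0 _] cg fc cg' gw wf cwf.
have [||||//] := @chain_idem_trivial g (w * c) cg.
- by rewrite mulrA -(mulrA w) cwf wf.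
- by rewrite mulrA gw.
- by rewrite -mulrA cg'.
move=> wc0; case/eqP: f0; rewrite -ff -cwf mulrA -(mulrA c w c) wc0 mulr0.
by rewrite mul0r.
Qed.

(** The corner $fBf$ is local: compare [d] with $f - d$. From $f - d = wd$ one reads off a left
    inverse $w + 1$ of [d], cut to the corner, and the swap makes it two-sided. *)
Lemma chain_idem_local f d : chain_idem f -> f * d = d -> d * f = d ->
  corner_unit f d \/ corner_unit f (f - d).
Proof.
move=> cf; have [ff f0 ch] := cf.
have inv d1 w : f * d1 = d1 -> d1 * f = d1 -> f - d1 = w * d1 -> corner_unit f d1.
  move=> fd df e; have ed : f * (w + 1) * f * d1 = f.
    by rewrite -!mulrA fd mulrDl mul1r -e subrK ff.
  exists (f * (w + 1) * f); split=> //.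
  - by rewrite !mulrA ff.
  - by rewrite -!mulrA ff.
  - by apply: (chain_idem_swap cf cf _ _ _ _ ed); rewrite ?fd ?df -?mulrA ?ff // mulrA ff.
move=> fd df; have [[w e]|[w e]] := ch d (f - d).
  right; apply: (inv _ w); [by rewrite mulrBr ff fd|by rewrite mulrBl ff df|].
  by move: e; rewrite mulrBl ff df subKr.
by left; apply: (inv _ w) => //; move: e; rewrite mulrBl ff df.
Qed.

(** The hard case $a = (b - ac)w$ gives $a(f + cw) = bw$. By locality either $f + cw$ is a unit and
    $a \in bB$, or $cw$ is a unit, [c] is invertible between the corners, and $b - ac \in aB$. *)
Lemma comparable_shift f g a b c : chain_idem f -> chain_idem g ->
  a * f = a -> b * g = b -> f * c = c -> c * g = c ->
  comparable a (b - a * c) -> comparable a b.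
Proof.
move=> cf cg af bg fc cg' [[w0 e0]|[w e]]; last first.
  by right; exists (w + c); rewrite mulrDr -e subrK.
have [ff _ _] := cf; have [gg _ _] := cg.
have abg : (b - a * c) * g = b - a * c by rewrite mulrBl bg -mulrA cg'.
have [w [e gw wf]] : exists w, [/\ a = (b - a * c) * w, g * w = w & w * f = w].
  exists (g * w0 * f); split; first by rewrite !mulrA abg -e0 af.
    by rewrite !mulrA gg.
  by rewrite -!mulrA ff.
have [||[t [ft tf tc ct]]|[t [ft tf tc ct]]] := @chain_idem_local f (- (c * w)) cf.
- by rewrite mulrN mulrA fc.
- by rewrite mulNr -mulrA wf.
- right; exists (c - t * c).
  have cwt : c * (w * - t) = f by rewrite mulrA mulrN -mulNr.
  have wtc : (w * - t) * c = g.
    apply: (chain_idem_swap cf cg fc cg' _ _ cwt); first by rewrite mulrA gw.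
    by rewrite -mulrA mulNr tf.
  have eb : b - a * c = - a * t * c.
    by rewrite -abg -wtc !mulrA -e mulrN !mulNr.
  by rewrite mulrBr -[b](subrK (a * c)) eb addrC !mulrA !mulNr.
- left; exists (w * t).
  have : a * (f + c * w) = b * w.
    rewrite mulrDr af {1}e mulrBl mulrA subrK //.
  rewrite opprK in ct tc; move=> ea.
  by rewrite mulrA -ea -mulrA ct af.
Qed.

Section Presentations.
Variables (X : lmodType B) (e : B).

(* X is the quotient of B f + B g by the submodule generated by (a, b), with [x] and
   [y] the images of the generators f and g. *)
Definition presented f g a b (x y : X) :=
  [/\ f *: x = x, g *: y = y, forall z, exists u v, z = u *: x + v *: y &
  forall u v, u *: x + v *: y = 0 <-> exists d, u * f = d * a /\ v * g = d * b].

Definition corner2 f g a b :=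
  [/\ e * a = a, a * f = a, e * b = b & b * g = b].

Lemma presentedC f g a b x y : presented f g a b x y -> presented g f b a y x.
Proof.
move=> [fx gy gen rel]; split=> // [z|u v].
  by have [u [v ->]] := gen z; exists v, u; rewrite addrC.
rewrite addrC; split=> [/rel|] [d [? ?]]; first by exists d.
by apply/rel; exists d.
Qed.

(** Substituting $x = s'(sx + ty) - s'ty$ is an invertible column operation on the row $(a, b)$. *)
Lemma presented_change f g a b x y s s' t : f * f = f ->
  presented f g a b x y -> corner2 f g a b ->
  f * s' = s' -> s' * f = s' -> f * s = s -> s * f = s -> s' * s = f -> s * s' = f ->
  f * t = t -> t * g = t ->
  presented f g (a * s') (b - a * s' * t) (s *: x + t *: y) y /\
  corner2 f g (a * s') (b - a * s' * t).
Proof.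
move=> ff [fx gy gen rel] [ea af eb bg] fs' s'f fs sf s's ss' ft tg.
have xE : x = s' *: (s *: x + t *: y) - (s' * t) *: y.
  by rewrite scalerDr !scalerA s's fx addrK.
split; last first.
  split; rewrite ?mulrBr ?mulrBl ?bg ?eb ?mulrA ?ea //.
    by rewrite -mulrA s'f.
  by rewrite -(mulrA (a * s')) tg.
split=> // [|z|u v].
- by rewrite scalerDr !scalerA fs ft.
- have [u [v ->]] := gen z; exists (u * s'), (v - u * (s' * t)).
  rewrite {1}xE scalerBr !scalerA scalerBl.
  by rewrite -!addrA; congr (_ + _); rewrite addrC.
rewrite scalerDr !scalerA -addrA -scalerDl.
split=> [/rel[d [e1 e2]]|[d [e1 e2]]].
  have e3 : u * f = d * (a * s').
    by rewrite mulrA -e1 -(mulrA u s f) sf -ss' mulrA.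
  exists d; split=> //.
  rewrite mulrBr -e2 mulrDl -[u * t * g]mulrA tg.
  by rewrite -[t in u * t]ft !mulrA e3 !mulrA addrAC subrr add0r.
apply/rel; exists d; split.
  by rewrite -mulrA sf -[s]fs mulrA e1 -!mulrA s's af.
rewrite mulrDl e2 -[u * t * g]mulrA tg -[t in u * t]ft mulrA e1.
by rewrite mulrBr !mulrA addrC subrK.
Qed.

(** The relation $x = cy$ yields $f = da$, so [a] is invertible between the corners of [e] and [f],
    and [b] is a right multiple of it. *)
Lemma presented_cyclic f g a b x y c : chain_idem e -> chain_idem f ->
  presented f g a b x y -> corner2 f g a b -> x = c *: y -> comparable a b.
Proof.
move=> ce cf [fx gy gen rel] [ea af eb bg] xcy; right.
have [ee _ _] := ce; have [ff _ _] := cf.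
have /rel[d [e1 e2]] : 1 *: x + (- c) *: y = 0 by rewrite scale1r scaleNr -xcy subrr.
rewrite mul1r in e1; pose d' := f * d * e.
have e3 : d' * a = f by rewrite /d' -!mulrA ea -e1 ff.
have e4 : a * d' = e.
  apply: (chain_idem_swap cf ce _ _ ea af e3); first by rewrite /d' !mulrA ff.
  by rewrite /d' -!mulrA ee.
by exists (d' * b); rewrite mulrA e4.
Qed.

(** Directness splits $ax + by = 0$, so $(a, 0) = d'(a, b)$ with [d'] in $eBe$. If [d'] is a unit
    then $b = 0$; if $e - d'$ is one then $a = 0$. *)
Lemma presented_split f g a b x y (Y Z : submodClosed X) : chain_idem e ->
  (forall z, z \in Y -> z \in Z -> z = 0) ->
  presented f g a b x y -> corner2 f g a b -> x \in Y -> y \in Z -> comparable a b.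
Proof.
move=> ce YZ0 [fx gy gen rel] [ea af eb bg] xY yZ.
have [ee _ _] := ce.
have /rel e0 : exists d, a * f = d * a /\ b * g = d * b.
  by exists 1; rewrite !mul1r.
have ax0 : a *: x = 0.
  apply: YZ0; first exact: rpredZ.
  move/eqP: e0; rewrite addr_eq0 => /eqP ->; by rewrite submN ?rpredZ.
have /rel[d [e1 e2]] : a *: x + 0 *: y = 0 by rewrite ax0 scale0r addr0.
rewrite af in e1; rewrite mul0r in e2; pose d' := e * d * e.
have e3 : d' * a = a by rewrite /d' -!mulrA ea -e1 ea.
have e4 : d' * b = 0 by rewrite /d' -!mulrA eb -e2 mulr0.
have [||[t [_ _ td _]]|[t [_ _ td _]]] := @chain_idem_local e d' ce.
- by rewrite /d' !mulrA ee.
- by rewrite /d' -!mulrA ee.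
- by right; exists 0; rewrite mulr0 -eb -td -mulrA e4 mulr0.
- by left; exists 0; rewrite mulr0 -ea -td -mulrA mulrBl e3 ea subrr mulr0.
Qed.

Section Decomposed.
Variables Y Z : submodClosed X.
Hypotheses (YZ0 : forall z, z \in Y -> z \in Z -> z = 0).
Hypothesis YZ1 : forall z : X, exists u w : X, [/\ u \in Y, w \in Z & z = u + w].

(** The components of [x] are $sx + ty$ in [Y] and $(f - s)x - ty$ in [Z]. One of [s], $f - s$ is a
    unit of $fBf$, so that component can replace [x]. *)
Lemma presented_adapt f g a b x y : chain_idem f -> chain_idem g ->
  presented f g a b x y -> corner2 f g a b ->
  exists a' b' x', [/\ presented f g a' b' x' y, corner2 f g a' b',
    x' \in Y \/ x' \in Z & comparable a' b' -> comparable a b].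
Proof.
move=> cf cg prs crn; have [fx gy gen rel] := prs; have [ea af eb bg] := crn.
have [ff _ _] := cf; have [gg _ _] := cg.
have [x1 [x2 [x1Y x2Z ex]]] := YZ1 x.
have fx1 : f *: x1 = x1.
  apply/eqP; rewrite -subr_eq0; apply/eqP/YZ0; first by rewrite submB ?rpredZ.
  have -> : f *: x1 - x1 = x2 - f *: x2.
    apply/eqP; rewrite subr_eq addrAC [x2 + x1]addrC -ex -{1}fx {1}ex scalerDr.
    by rewrite addrK.
  by rewrite submB ?rpredZ.
have [u [v ex1]] := gen x1.
pose s := f * u * f; pose t := f * v * g.
have {}ex1 : x1 = s *: x + t *: y.
  by rewrite -fx1 ex1 scalerDr !scalerA -{1}fx -{1}gy !scalerA.
have fs : f * s = s by rewrite /s !mulrA ff.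
have sf : s * f = s by rewrite /s -!mulrA ff.
have ft : f * t = t by rewrite /t !mulrA ff.
have tg : t * g = t by rewrite /t -!mulrA gg.
have concl s1 s1' t1 : f * s1 = s1 -> s1 * f = s1 -> f * t1 = t1 -> t1 * g = t1 ->
    f * s1' = s1' -> s1' * f = s1' -> s1' * s1 = f -> s1 * s1' = f ->
    (s1 *: x + t1 *: y \in Y \/ s1 *: x + t1 *: y \in Z) ->
  exists a' b' x', [/\ presented f g a' b' x' y, corner2 f g a' b',
    x' \in Y \/ x' \in Z & comparable a' b' -> comparable a b].
  move=> fs1 s1f ft1 t1g fs1' s1f' h1 h2 hx.
  have [prs' crn'] := presented_change ff prs crn fs1' s1f' fs1 s1f h1 h2 ft1 t1g.
  exists (a * s1'), (b - a * s1' * t1), (s1 *: x + t1 *: y); split=> //.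
  move=> cmp; have [] : comparable (a * s1') b.
    by apply: (comparable_shift cf cg _ bg ft1 t1g cmp); rewrite -mulrA s1f'.
  - by move=> [w ew]; left; exists (w * s1); rewrite mulrA -ew -mulrA h1 af.
  - by move=> [w ew]; right; exists (s1' * w); rewrite mulrA.
have [[s' [fs' s'f s's ss']]|[s' [fs' s'f s's ss']]] := chain_idem_local cf fs sf.
  by apply: (concl s s' t) => //; left; rewrite -ex1.
apply: (concl (f - s) s' (- t)) => //.
- by rewrite mulrBr ff fs.
- by rewrite mulrBl ff sf.
- by rewrite mulrN ft.
- by rewrite mulNr tg.
- right; suff -> : (f - s) *: x + - t *: y = x2 by [].
  rewrite scalerBl fx scaleNr -addrA -opprD -ex1 ex.
  by rewrite addrC addKr.
Qed.

(** After adapting both generators, each lies in a summand; both in the same one would make the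
    other summand zero. *)
Lemma presented_decomposed f g a b x y : chain_idem e -> chain_idem f ->
  chain_idem g -> Y <> zero_submod X -> Z <> zero_submod X ->
  presented f g a b x y -> corner2 f g a b -> comparable a b.
Proof.
move=> ce cf cg Y0 Z0 prs crn.
have [a1 [b1 [x1 [prs1 crn1 hx1 imp1]]]] := presented_adapt cf cg prs crn.
apply: imp1.
have crn1C : corner2 g f b1 a1 by case: crn1.
have [b2 [a2 [y2 [prs2 crn2 hy2 imp2]]]] := presented_adapt cg cf (presentedC prs1) crn1C.
have cmpC a' b' : comparable a' b' -> comparable b' a' by case; [right|left].
apply/cmpC/imp2; have [fx gy gen _] := prs2.
have ZY0 z : z \in Z -> z \in Y -> z = 0 by move=> ? ?; apply: YZ0.
case: hx1 hy2 => [xY|xZ] [yY|yZ].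
- case: Z0; apply: sub_anti; last exact: sub0.
  move=> z zZ; have [u [v ez]] := gen z; rewrite (YZ0 (z := z)) ?rpred0 //.
  by rewrite ez rpredD ?rpredZ.
- exact: presented_split ce ZY0 prs2 crn2 yZ xY.
- exact: presented_split ce YZ0 prs2 crn2 yY xZ.
- case: Y0; apply: sub_anti; last exact: sub0.
  move=> z zY; have [u [v ez]] := gen z; rewrite (YZ0 (z := z)) ?rpred0 //.
  by rewrite ez rpredD ?rpredZ.
Qed.

End Decomposed.

End Presentations.

End ChainIdempotents.

(** * Projective left modules *)

Section AllUniserial.
Variable B : pzRingType.
Hypothesis fB : finlen B^o.
Hypothesis uniB : forall M : lmodType B,
  finitely_generated M -> indecomposable M -> uniserial M.

Lemma not_indecomposable (M : lmodType B) : full_submod M <> zero_submod M ->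
  ~ indecomposable M -> exists Y Z : submodClosed M,
    [/\ forall x, x \in Y -> x \in Z -> x = 0,
        forall x, exists u v, [/\ u \in Y, v \in Z & x = u + v],
        Y <> zero_submod M & Z <> zero_submod M].
Proof.
move=> nz nI; apply: contrapT => nex; apply: nI; split=> // Y Z YZ0 YZ1.
apply: contrapT => /not_orP[Y0 Z0]; apply: nex; by exists Y, Z.
Qed.

Section Pair.
Variables e f g a b : B.
Hypotheses (ce : chain_idem e) (cf : chain_idem f) (cg : chain_idem g).
Hypothesis crn : corner2 e f g a b.

(** Preimage of $B(a, b)$ under $(p, q) \mapsto (pf, qg)$: the quotient of $B \oplus B$ is $(Bf
    \oplus Bg)/B(a, b)$, without $Bf$ and $Bg$ as separate modules. *)
Definition pair_rel : submodClosed (B^o * B^o)%type.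
Proof.
apply: (@mksub B (B^o * B^o)%type
  (fun p => exists d : B, (p.1 : B) * f = d * a /\ (p.2 : B) * g = d * b)).
  by exists 0; rewrite !mul0r.
move=> r [p q] [p' q'] [d [/= e1 e2]] [d' [/= e1' e2']]; exists (r * d + d').
split; rewrite /= mulrDl -[_ *: _]/(r * _) -mulrA.
  by rewrite e1 e1' mulrDl mulrA.
by rewrite e2 e2' mulrDl mulrA.
Defined.

Lemma all_comparable : comparable a b.
Proof.
pose X : lmodType B := quotmod pair_rel.
pose x : X := piQ pair_rel (f, 0); pose y : X := piQ pair_rel (0, g).
have [ff _ _] := cf; have [gg _ _] := cg.
have xyE u v : u *: x + v *: y = piQ pair_rel (u * f, v * g).
  rewrite /x /y -!linearZ -linearD /=.
  by congr (piQ _ (_, _)); rewrite /= scaler0 ?addr0 ?add0r.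
have relX u v : u *: x + v *: y = 0 <-> exists d, u * f = d * a /\ v * g = d * b.
  rewrite xyE; split=> [/eqP|[d [e1 e2]]].
    rewrite piQ_eq0 => /mksubP[d [/= e1 e2]]; exists d.
    by rewrite -e1 -e2 -!mulrA ff gg.
  apply/eqP; rewrite piQ_eq0; apply/mksubP; exists d => /=.
  by rewrite -!mulrA ff gg.
have prs : presented f g a b x y.
  split=> //.
  - by have := xyE f 0; rewrite ff mul0r scale0r addr0.
  - by have := xyE 0 g; rewrite gg mul0r scale0r add0r.
  move=> z; have [[u v] <-] := piQ_surj z; exists u, v; rewrite xyE.
  apply/eqP; rewrite -subr_eq0 -linearB piQ_eq0; apply/mksubP; exists 0 => /=.
  by rewrite !mul0r !mulrBl -!mulrA ff gg !subrr.
have fgX : finitely_generated X.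
  apply: fg_surj (@piQ_surj _ _ pair_rel) _.
  by apply: fg_prod; apply: fg_regular.
have [X0|nX0] := pselect (full_submod X = zero_submod X).
  apply: (presented_cyclic (c := 0) ce cf prs crn); rewrite scale0r; apply/eqP.
  by have : x \in full_submod X by []; rewrite X0.
have [iX|nX] := pselect (indecomposable X); last first.
  have [Y [Z [YZ0 YZ1 Y0 Z0]]] := not_indecomposable nX0 nX.
  exact: (presented_decomposed YZ0 YZ1 ce cf cg Y0 Z0 prs crn).
have [_ /(_ (cyclicS x) (cyclicS y))] := (uniserialP X).1 (uniB fgX iX).
case; try exact: sub0.
  by move=> /(_ x (cyclicS_id x))/cyclicSP[c]; apply: (presented_cyclic ce cf prs crn).
move=> /(_ y (cyclicS_id y))/cyclicSP[c ey].
have crnC : corner2 e g f b a by case: crn.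
have [] := presented_cyclic ce cg (presentedC prs) crnC ey; by [right|left].
Qed.

End Pair.

Section Corner.
Variable f : B.
Hypothesis (ff : f * f = f).

(** The quotient of [B] by this kernel serves as $Bf$. *)
Lemma idem_kernel_exists : {L : submodClosed B^o | forall b : B, b \in L <-> b * f = 0}.
Proof.
have P0 : (0 : B) * f = 0 by rewrite mul0r.
have PD (a : B) (u v : B^o) : (u : B) * f = 0 -> (v : B) * f = 0 ->
    ((a *: u + v : B^o) : B) * f = 0.
  by move=> uf vf; rewrite mulrDl vf addr0 -[_ *: _]/(a * _) -mulrA uf mulr0.
exists (@mksub _ B^o (fun b : B => b * f = 0) P0 PD) => b.
exact: iff_sym (rwP (mksubP P0 PD b)).
Qed.

(** The components of the class of $1$ lift to [u] and [v] with $f = u + v$. The class of $uv = u -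
    u^2$ lies in both summands, so $uv = 0$; likewise $vu = 0$. *)
Lemma idem_split : f != 0 -> ~ chain_idem f ->
  exists u v, [/\ u * u = u, v * v = v, u * v = 0, v * u = 0 &
    [/\ f = u + v, u != 0 & v != 0]].
Proof.
move=> f0 nch; have [L LP] := idem_kernel_exists.
have pi0 b : piQ L b = 0 <-> b * f = 0.
  split=> [e|e]; first by apply/LP; have := piQ_eq0 L b; rewrite e eqxx => /esym.
  by apply/eqP; rewrite (piQ_eq0 L b); apply/LP.
have piB (b b' : B) : piQ L b - piQ L b' = piQ L (b - b') by rewrite linearB.
have piE b b' : piQ L b = piQ L b' <-> b * f = b' * f.
  split=> e; apply/eqP; rewrite -subr_eq0; apply/eqP.
    by rewrite -mulrBl; apply/pi0; rewrite -piB e subrr.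
  by rewrite piB; apply/pi0; rewrite mulrBl e subrr.
have piZ (a b : B) : a *: piQ L b = piQ L (a * b) by rewrite -linearZ.
have nz : full_submod (quotmod L) <> zero_submod (quotmod L).
  move=> e; case/eqP: f0; rewrite -(mul1r f); apply/pi0/eqP.
  by have : piQ L 1 \in full_submod (quotmod L) by []; rewrite e.
have fgL : finitely_generated (quotmod L).
  exact: fg_surj (@piQ_surj _ _ L) (fg_regular B).
have [iL|] := pselect (indecomposable (quotmod L)).
  case: nch; split=> // u v.
  have [_ tot] := (uniserialP _).1 (uniB fgL iL).
  have [||uv|vu] := tot (cyclicS (piQ L u)) (cyclicS (piQ L v)); try exact: sub0.
    left; have /uv/cyclicSP[w] := cyclicS_id (piQ L u).
    by rewrite piZ => /piE ->; exists w; rewrite mulrA.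
  right; have /vu/cyclicSP[w] := cyclicS_id (piQ L v).
  by rewrite piZ => /piE ->; exists w; rewrite mulrA.
move/(not_indecomposable nz) => [Y [Z [YZ0 YZ1 Y0 Z0]]].
have [p [q [pY qZ epq]]] := YZ1 (piQ L 1).
have lift r : exists2 u, u * f = u & piQ L u = r.
  have [u eu] := piQ_surj r; exists (u * f); first by rewrite -mulrA ff.
  by rewrite -eu; apply/piE; rewrite -mulrA ff.
have [u uf eu] := lift p; have [v vf ev] := lift q.
have fuv : f = u + v.
  have : piQ L 1 = piQ L (u + v) by rewrite epq -eu -ev -linearD.
  by move/piE; rewrite mul1r mulrDl uf vf.
have in0 w : w * f = w -> piQ L w \in Y -> piQ L w \in Z -> w = 0.
  by move=> wf wY wZ; rewrite -wf; apply/pi0/YZ0.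
have uv : u * v = u - u * u.
  by rewrite -{2}uf fuv mulrDr addrC addKr.
have vu : v * u = v - v * v.
  by rewrite -{2}vf fuv mulrDr addrK.
have uv0 : u * v = 0.
  apply: in0; first by rewrite -mulrA vf.
    by rewrite uv -piB -piZ eu; apply: submB => //; apply: rpredZ.
  by rewrite -piZ ev rpredZ.
have vu0 : v * u = 0.
  apply: in0; first by rewrite -mulrA uf.
    by rewrite -piZ eu rpredZ.
  by rewrite vu -piB -piZ ev; apply: submB => //; apply: rpredZ.
have gen1 (K : submodClosed (quotmod L)) : piQ L 1 \in K -> forall z, z \in K.
  move=> K1 z; have [b <-] := piQ_surj z.
  by rewrite -[b]mulr1 -piZ rpredZ.
exists u, v; split=> //.
- by apply/esym/eqP; rewrite -subr_eq0 -uv uv0.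
- by apply/esym/eqP; rewrite -subr_eq0 -vu vu0.
split=> //; apply/eqP => e0.
- case: Y0; apply: sub_anti; last exact: sub0.
  move=> z zY; rewrite (YZ0 z) ?rpred0 //; apply: gen1.
  by rewrite epq -eu e0 linear0 add0r.
- case: Z0; apply: sub_anti; last exact: sub0.
  move=> z zZ; rewrite (YZ0 z) ?rpred0 //; apply: gen1.
  by rewrite epq -ev e0 linear0 addr0.
Qed.

End Corner.

Lemma idem_decompose f : f * f = f ->
  exists s : seq B, f = \sum_(x <- s) x /\ forall x, x \in s -> chain_idem x.
Proof.
have [mu smu] := finlen_rank fB.
have [n] := ubnP (mu (cyclicS (f : B^o))); elim: n f => // n IHn f lt_n ff.
have [->|f0] := eqVneq f 0; first by exists [::]; rewrite big_nil.
have [cf|ncf] := pselect (chain_idem f).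
  by exists [:: f]; rewrite big_seq1; split=> // x; rewrite inE => /eqP ->.
have [u [v [uu vv uv vu [fuv u0 v0]]]] := idem_split ff f0 ncf.
have smaller u' v' : u' * u' = u' -> v' * v' = v' -> u' * v' = 0 -> v' * u' = 0 ->
    f = u' + v' -> v' != 0 -> (mu (cyclicS (u' : B^o)) < n)%N.
  move=> uu' vv' uv' vu' fuv' v0'; rewrite ltnS in lt_n; apply: leq_trans lt_n.
  apply: smu => [||//|e]; first exact: sub0.
    move=> _ /cyclicSP[c ->]; apply/cyclicSP; exists (c * u').
    by rewrite -[RHS]/(c * u' * f) -mulrA fuv' mulrDr uu' uv' addr0.
  have : (v' : B^o) \in cyclicS (u' : B^o).
    rewrite e; apply/cyclicSP; exists v'.
    by rewrite -[RHS]/(v' * f) fuv' mulrDr vu' add0r vv'.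
  case/cyclicSP=> w; rewrite -[RHS]/(w * u') => ew.
  by case/eqP: v0'; rewrite -vv' {1}ew -mulrA uv' mulr0.
have [s [es cs]] := IHn u (smaller u v uu vv uv vu fuv v0) uu.
have [|t [et ct]] := IHn v (smaller v u vv uu vu uv _ u0) vv.
  by rewrite fuv addrC.
exists (s ++ t); rewrite big_cat -es -et; split=> // x.
by rewrite mem_cat => /orP[/cs|/ct].
Qed.

End AllUniserial.

Section Projective.
Variables (A : pzRingType) (P : lmodType A).
Variable I : seq A.
Hypothesis I1 : 1 = \sum_(x <- I) x.
Hypothesis Iidem : forall e, e \in I -> e * e = e /\ e != 0.
Hypothesis Iloc : forall e d, e \in I -> e * d = d -> d * e = d ->
  corner_unit e d \/ corner_unit e (e - d).
Hypothesis Icmp : forall e f g a b, e \in I -> f \in I -> g \in I ->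
  a * e = a -> f * a = a -> b * e = b -> g * b = b ->
  (exists w, a = w * b) \/ (exists w, b = w * a).
Hypotheses (iP : indecomposable P) (pP : projective P).

(* Lift P -> P / <s> along A -> P / <s>, a |-> a x. *)
Lemma projective_coordinate (x : P) (s : seq P) : generates (x :: s) ->
  exists phi : {linear P -> A^o}, forall (z : P) (K : submodClosed P),
    {subset s <= K} -> z - (phi z : A) *: x \in K.
Proof.
move=> gs.
have P0 K : {subset s <= (K : submodClosed P)} -> 0 \in K by move=> _; apply: rpred0.
have PD (a : A) u v : (forall K : submodClosed P, {subset s <= K} -> u \in K) ->
    (forall K : submodClosed P, {subset s <= K} -> v \in K) ->
    forall K : submodClosed P, {subset s <= K} -> a *: u + v \in K.
  by move=> Ku Kv K sK; apply: rpredD; [apply/rpredZ/Ku|apply: Kv].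
pose N := mksub P0 PD.
have sN : {subset s <= N} by move=> y ys; apply/mksubP => K; apply.
have [v|phi phiP] := @pP A^o (quotmod N) (smul (piQ N x)) (piQ N).
  have [z <-] := piQ_surj v.
  have : z \in addS N (cyclicS x).
    apply: gs => y; rewrite inE => /orP[/eqP ->|/sN]; last exact: addSl.
    by apply/addSr/cyclicS_id.
  case/addSP=> n Nn /cyclicSP[a ea]; exists a.
  apply/eqP; rewrite -subr_eq0 /= /smul -linearZ -linearB piQ_eq0.
  by rewrite -ea addrAC subrr add0r submN.
exists phi => z K sK; suff : z - (phi z : A) *: x \in N by move/mksubP; apply.
rewrite -piQ_eq0 linearB linearZ /= -phiP /= /smul.
by rewrite subrr.
Qed.

Lemma projective_embeds (s : seq P) :
  (forall x, x \in s -> exists2 e, e \in I & e *: x = x) ->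
  generates s ->
  exists e (phi : {linear P -> A^o}), [/\ e \in I, injective phi &
    forall z, (phi z : A) * e = phi z].
Proof.
elim: s => [|x s IHs] sI gs.
  case: iP => nz _; case: nz; apply: sub_anti; last exact: sub0.
  by move=> y _; apply: gs.
have [e eI ex] := sI x (mem_head _ _); have [ee e0] := Iidem eI.
have [phi phiP] := projective_coordinate gs.
pose psi : {linear P -> A^o} := smul (e : A^o) \o phi.
have psiE z : psi z = (phi z : A) * e by [].
have psie z : (psi z : A) * e = psi z by rewrite psiE -mulrA ee.
have psiZ (a : A) z : psi (a *: z) = a * (psi z : A) by rewrite linearZ.
have psix z : (psi z : A) *: x = (phi z : A) *: x by rewrite psiE -scalerA ex.
pose c : A := psi x.
have ec : e * c = c by rewrite /c -psiZ ex.
have [[d [ed de dc cd]]|[d [ed de dc cd]]] := Iloc eI ec (psie x).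
  exists e, psi; split=> //.
  have PZ0 : psi 0 = 0 by rewrite linear0.
  have PZD (a : A) u v : psi u = 0 -> psi v = 0 -> psi (a *: u + v) = 0.
    by move=> u0 v0; rewrite linearD psiZ u0 v0 mulr0 addr0.
  have x0 : x <> 0.
    by move=> x0; case/eqP: e0; rewrite -dc /c x0 linear0 mulr0.
  have [_ ind] := iP; have [||Y0|Z0] := ind (cyclicS x) (mksub PZ0 PZD).
  - move=> _ /cyclicSP[a ->] /mksubP; rewrite psiZ -/c => ac0.
    by rewrite -ex -cd !scalerA mulrA ac0 mul0r scale0r.
  - move=> z; exists (((psi z : A) * d) *: x), (z - ((psi z : A) * d) *: x); split.
    + by apply/cyclicSP; exists ((psi z : A) * d).
    + apply/mksubP; rewrite linearB psiZ -/c -mulrA dc psie subrr //.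
    + by rewrite addrC subrK.
  - by case: x0; apply/eqP; have := cyclicS_id x; rewrite Y0.
  - move=> z z' ezz; apply/eqP; rewrite -subr_eq0.
    have : z - z' \in mksub PZ0 PZD by apply/mksubP; rewrite linearB ezz subrr.
    by rewrite Z0.
apply: IHs => [y ys|K sK y]; first by apply: sI; rewrite inE ys orbT.
apply: (gs K) => z; rewrite inE => /orP[/eqP ->|/sK//].
have := phiP x K sK; rewrite -psix -/c -{1}ex -scalerBl => /(@rpredZ _ _ K d).
by rewrite scalerA dc ex.
Qed.

(** Witnesses of incomparability can be cut down by idempotents to $fP$ and $gP$. Their images in
    $Ae$ are comparable, and injectivity carries the comparison back. *)
Lemma projective_total : finitely_generated P -> total_submod P.
Proof.
move=> /fg_generates[s gs].
have sumI (x : P) : x = \sum_(e <- I) e *: x by rewrite -scaler_suml -I1 scale1r.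
have [|K sK x|e [phi [eI injphi phie]]] :=
    @projective_embeds [seq e *: x | x <- s, e <- I].
- move=> _ /allpairsP[[x e] [/= xs eI ->]]; exists e => //.
  by rewrite scalerA; have [-> _] := Iidem eI.
- apply: gs => y ys; rewrite (sumI y) big_seq; apply: rpred_sum => e eI.
  by apply: sK; apply/allpairsP; exists (y, e).
have piece (L L' : submodClosed P) : ~ {subset L <= L'} ->
    exists (f : A) (x : P), [/\ f \in I, f *: x = x, x \in L & x \notin L'].
  move=> /notsub[x xL nxL']; apply: contrapT => nex; case/negP: nxL'.
  rewrite (sumI x) big_seq; apply: rpred_sum => f fI; apply: contrapT => /negP nfx.
  apply: nex; exists f, (f *: x); split=> //; last exact: rpredZ.
  by rewrite scalerA; have [-> _] := Iidem fI.
move=> L L' _ _; apply: contrapT => /not_orP[/piece[f [x [fI fx xL nx]]]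
  /piece[g [y [gI gy yL ny]]]].
have phiZ (a : A) z : phi (a *: z) = a * (phi z : A) by rewrite linearZ.
have [||||[w ew]|[w ew]] := @Icmp e f g (phi x) (phi y) eI fI gI.
- exact: phie.
- by rewrite -phiZ fx.
- exact: phie.
- by rewrite -phiZ gy.
- by case/negP: nx; rewrite (injphi x (w *: y)) ?rpredZ // phiZ.
- by case/negP: ny; rewrite (injphi y (w *: x)) ?rpredZ // phiZ.
Qed.

End Projective.

(** * The Nakayama property and the range of the factor-serial index *)

Lemma nakayama_of_uniserial (A : pzRingType) :
  finlen A^o -> finlen (A^c)^o ->
  (forall M : lmodType A^c, finitely_generated M -> indecomposable M -> uniserial M) ->
  nakayama A.
Proof.
move=> fA fAc uniA; split=> [P fgP iP _|P fgP iP pP]; first exact: uniA.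
apply/uniserialP; split; first exact: fg_finlen.
(* The decomposition is made in $A^c$; its corner and comparability properties are read in [A] with
   products reversed. *)
have [I [I1 cI]] := idem_decompose fAc uniA (mulr1 (1 : A^c)).
apply: (@projective_total A P I I1) => //.
- by move=> e /cI[ee e0 _].
- move=> e d /cI ce ed de.
  by have [[d' [? ? ? ?]]|[d' [? ? ? ?]]] := chain_idem_local ce de ed;
    [left|right]; exists d'.
- move=> e f g a b /cI ce /cI cf /cI cg ae fa be gb.
  have [[w ew]|[w ew]] := all_comparable uniA ce cf cg (And4 ae fa be gb).
    by left; exists w.
  by right; exists w.
Qed.

(** The index is $l - k$: at least 2 by $k + 2 \le l$, and at most [m] because $l = m + 1$ comes
    with locality, hence $k \ge 1$. *)
Lemma factor_serial_small (A : pzRingType) (M : lmodType A) l m :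
  has_length M l -> (1 < m)%N -> (l <= m.+1)%N -> (l = m.+1 -> local M) ->
  exists i, (1 <= i <= m)%N /\ factor_serial M i.
Proof.
move=> hl m1 lm loc; have fM : finlen M by exists l.
have [uM|nu] := pselect (uniserial M); first by exists 1; split=> //; apply: ltnW.
have [k [kl uk nuk lock]] := factor_serial_index fM hl nu.
exists (l - k)%N; split.
  have [/loc/lock|] := eqVneq l m.+1; lia.
have : (1 < l - k)%N by lia.
case en : (l - k)%N => [|[|n]] // _; split=> //; exists l.
rewrite -en subKn ?addn1; last by lia.
by split=> //; lia.
Qed.

(** If the bound [n] is not attained, then $n - 1$ is also a bound and is attained by induction,
    which is an excluded case. At bound 1 all modules are uniserial and the ring would be
    Nakayama. *)
Lemma right_nakayama_exists (A : pzRingType) n : finlen A^o -> finlen (A^c)^o ->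
  ~ nakayama A -> (forall i, (1 < i < n)%N -> ~ right_nakayama i A) ->
  (0 < n)%N ->
  (forall M : lmodType A^c, finitely_generated M -> indecomposable M ->
     exists i, (1 <= i <= n)%N /\ factor_serial M i) ->
  exists M : lmodType A^c,
    [/\ finitely_generated M, indecomposable M & factor_serial M n].
Proof.
move=> fA fAc notN; elim: n => // n IHn notn _ allM.
apply: contrapT => nex.
have allM' (M : lmodType A^c) : finitely_generated M -> indecomposable M ->
    exists i, (1 <= i <= n)%N /\ factor_serial M i.
  move=> fgM iM; have [i [/andP[i1 i2] fi]] := allM M fgM iM; exists i; split=> //.
  rewrite i1 /= -ltnS ltn_neqAle i2 andbT; apply/eqP => e; apply: nex.
  by exists M; split=> //; rewrite -e.
(* A missed bound 1 leaves no finitely generated indecomposable right module, so uniseriality holds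
   vacuously. *)
case: n => [|n] in IHn notn nex allM allM' *.
  apply: notN; apply: nakayama_of_uniserial => // M fgM iM.
  by have [i [h _]] := allM' M fgM iM; move: h; case: i.
have [|//|M exM] := IHn _ _ allM'; first by move=> i hi; apply: notn; lia.
case: n => [|n] in IHn notn nex allM allM' exM *.
  apply: notN; apply: nakayama_of_uniserial => // M' fgM iM.
  by have [[|[|i]] [h f]] := allM' M' fgM iM.
by apply: (notn n.+2); [lia|split=> //; exists M].
Qed.

Theorem theorem2p5 (R : comPzRingType) (Lambda : algType R)
  (artinL : artin_algebra Lambda)
  (notN : ~ nakayama Lambda)
  (notN2 : ~ right_nakayama 2 Lambda)
  (notN3 : ~ right_nakayama 3 Lambda) :
  right_nakayama 4 Lambda <->
  (forall M : lmodType Lambda^c, finitely_generated M -> indecomposable M ->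
     forall l : nat, has_length M l -> (5 < l)%N -> uniserial M)
  /\ (forall M : lmodType Lambda^c, finitely_generated M -> indecomposable M ->
     has_length M 5 -> local M).
Proof.
have fL := artin_algebra_finlen_left artinL.
have fLc := artin_algebra_finlen_right artinL.
split=> [[all4 _]|[uni5 loc5]].
  have loc (M : lmodType Lambda^c) l : finitely_generated M -> indecomposable M ->
      has_length M l -> (4 < l)%N -> local M.
    move=> fgM iM hl l5; have [i [/andP[_ i4] fi]] := all4 M fgM iM.
    by apply: (factor_serial_local iM.1 hl _ fi); lia.
  split=> [M fgM iM l hl l5|M fgM iM h5]; last exact: loc h5 _.
  have fM : finlen M by exists l.
  apply: contrapT => nu; have [i [/andP[_ i4] fi]] := all4 M fgM iM.
  have [k k1 [ch nch]] : exists2 k, (1 < k)%N &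
      chain_above (rad_iter M k) /\ ~ chain_above (rad_iter M k.+1).
    case: i i4 fi => [|[|i]] // i4 [_ [l' [hl' il' u nu']]].
    (* The index [i.+2] is at most 4 and the length exceeds 5, so the exponent is at least 2. *)
    exists (l' - i.+2)%N.
      by rewrite (clen_uniq ((has_lengthP M l').1 hl') ((has_lengthP M l).1 hl)); lia.
    split; first exact/(quot_uniserial _ fM).
    by move=> ch; apply/nu'/(quot_uniserial _ fM); rewrite addn1.
  have [K1 [K2 [c1 c2 n12]]] := two_maximal fM ch nch.
  have [X [fgX iX nlX lenX]] := exists_glued fLc fgM k1 ch c1 c2 n12.
  have [lX hlX] := fg_finlen fLc fgX.
  by apply: nlX; apply: loc hlX (lenX _ hlX).
have all4 (M : lmodType Lambda^c) : finitely_generated M -> indecomposable M ->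
    exists i, (1 <= i <= 4)%N /\ factor_serial M i.
  move=> fgM iM; have [l hl] := fg_finlen fLc fgM.
  have [l5|l5] := ltnP 5 l; first by exists 1; split=> //; apply: uni5 hl l5.
  by apply: (factor_serial_small hl) => // e; rewrite e in hl; apply: loc5.
split=> //; apply: right_nakayama_exists => // -[|[|[|[|i]]]] //.
Qed.
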